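(* Let $(L_n)_{n\ge1}$ be a sequence of positive integers and $(\lambda_n)_{n\ge1}$ a sequence of real numbers in $(0,1]$ such that $$\sup\{L_n\lambda_n : n\ge1\}=\infty,$$ and let $\nu=\nu(L_n,\lambda_n)$ be the associated product probability measure on $X=\prod_{k\ge1}\{0,1\}$. Then the associated flow of the natural action of $S_\infty$ on $(X,\nu)$ is approximately transitive (AT).
   Context: For $0<\lambda\le1$, $\nu_\lambda$ is the probability measure on $\{0,1\}$ with $\nu_\lambda(0)=\frac1{1+\lambda}$, $\nu_\lambda(1)=\frac{\lambda}{1+\lambda}$. Identify $X=\prod_{k\ge1}\{0,1\}=\prod_{n\ge1}\prod_{1}^{L_n}\{0,1\}$ and set $\nu(L_n,\lambda_n)=\otimes_{n\ge1}\nu_{\lambda_n}^{\otimes L_n}$; that is, with $k_0=0$ and $k_n=L_1+\dots+L_n$, the factor at coordinate $i$ is $\nu_{\lambda_n}$ whenever $k_{n-1}<i\le k_n$. $S_\infty=\bigcup_{k\ge1}S_k$ is the group of finite permutations of $\mathbb{N}=\{1,2,3,\dots\}$. Its natural action on $X$ associates to $\sigma\in S_\infty$ the non-singular automorphism $\sigma(x_1,x_2,\dots)=(x_{\sigma(1)},x_{\sigma(2)},\dots)$ of $(X,\nu)$. Associated flow: for a non-singular action of a countable discrete group $G$ on a Lebesgue space $(X,\nu)$, consider on $(X\times\mathbb{R},\nu\otimes e^u\,du)$ the transformations $\gamma_g(x,t)=\big(gx,\,t-\log\frac{d\nu\circ g}{d\nu}(x)\big)$, $g\in G$ (which preserve the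 infinite measure $\nu\otimes e^u\,du$) and the translations $\rho_s(x,t)=(x,t+s)$, $s\in\mathbb{R}$. Since $\rho$ commutes with $\gamma$, it induces an $\mathbb{R}$-action on the space of the ergodic decomposition of $\gamma$ (the Lebesgue space $Z$, with its natural measure class, for which $L^\infty(Z)$ is the algebra of $\gamma$-invariant functions in $L^\infty(X\times\mathbb{R},\nu\otimes e^u\,du)$). This $\mathbb{R}$-action on $Z$ is the associated flow (the Mackey range of the Radon-Nikodym cocycle). Approximate transitivity: an action $\alpha$ of a Borel group $G$ by non-singular automorphisms of a Lebesgue measure space $(Y,\nu)$ is approximately transitive (AT) if for every $n<\infty$, all $f_1,\dots,f_n\in L^1_+(Y,\nu)$ (nonnegative integrable functions) and every $\varepsilon>0$, there exist $f\in L^1_+(Y,\nu)$, finitely many elements $g_1,\dots,g_m\in G$, and reals $\lambda_{j,k}\ge 0$ ($1\le j\le n$, $1\le k\le m$) such that $$\Big\|f_j-\sum_{k=1}^m\lambda_{j,k}\,\beta_{g_k}(f)\Big\|\le\varepsilon,\qquad j=1,\dots,n,$$ where $\|\cdot\|$ is the $L^1(Y,\nu)$ norm and $\beta_g(f)(y)=f(\alpha_g^{-1}y)\,\frac{d(\nu\circ\alpha_g^{-1})}{d\nu}(y)$, with $(\nu\circ\alpha_g^{-1})(A)=\nu(\alpha_g^{-1}A)$. The property depends only on the equivalence class of the ($\sigma$-finite) measure, and only on the family of automorphisms $\{\alpha_g\}$. *)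

(* Defs.v *)
From HB Require Import structures.
From mathcomp Require Import all_boot all_order all_algebra.
From mathcomp Require Import all_classical all_reals all_analysis.
From mathcomp Require Import measurable_realfun.
Set Implicit Arguments.
Unset Strict Implicit.
Unset Printing Implicit Defensive.
Import Order.TTheory GRing.Theory Num.Theory.
Import numFieldNormedType.Exports.
Local Open Scope classical_set_scope.
Local Open Scope ring_scope.

Record automorphism d (T : measurableType d) := Automorphism {
  aut_fun :> T -> T;
  aut_inv_fun : T -> T;
  aut_funK : cancel aut_fun aut_inv_fun;
  aut_invK : cancel aut_inv_fun aut_fun;
  measurable_aut_fun : measurable_fun setT aut_fun;
  measurable_aut_inv_fun : measurable_fun setT aut_inv_fun }.

Definition aut_inv d (T : measurableType d) (g : automorphism T) :=
  Automorphism (aut_invK g) (aut_funK g)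
    (measurable_aut_inv_fun g) (measurable_aut_fun g).

Section radon_nikodym_cocycle.
Context d (T : measurableType d) (R : realType).
Implicit Types (mu nu : set T -> \bar R) (g : automorphism T).

Definition nonsingular mu g :=
  forall A, measurable A -> mu (g @` A) = 0%E <-> mu A = 0%E.

Definition is_rn_derivative nu mu (D : T -> R) :=
  [/\ measurable_fun setT D, (forall x, 0 <= D x) &
    forall A, measurable A -> nu A = (\int[mu]_(x in A) (D x)%:E)%E].

(* ['d nu '/d mu] of [charge.v] needs a finite [nu], whereas [mu \o image g]
   below is only sigma-finite in general *)
Definition rn_derivative nu mu : T -> R :=
  xget (cst 0) [set D | is_rn_derivative nu mu D].

(* d(mu o g) / dmu, with (mu o g)(A) = mu (g A) *)
Definition rn_cocycle mu g : T -> R :=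
  rn_derivative (fun A => mu (g @` A)) mu.

End radon_nikodym_cocycle.

Lemma rn_derivativeP d (T : measurableType d) (R : realType)
    (nu : {finite_measure set T -> \bar R})
    (mu : {sigma_finite_measure set T -> \bar R}) :
  nu `<< mu -> is_rn_derivative nu mu (rn_derivative nu mu).
Proof.
move=> numu; rewrite /rn_derivative; case: xgetP => [//|/=].
pose f := Radon_Nikodym_SigmaFinite.f nu mu.
have ffin x : f x \is a fin_num by exact: Radon_Nikodym_SigmaFinite.f_fin_num.
move=> /(_ (fine \o f)); case; split.
- apply/measurable_EFinP.
  rewrite [X in measurable_fun _ X](_ : _ = f); last first.
    by apply/funext => x /=; rewrite fineK.
  exact/measurable_int/Radon_Nikodym_SigmaFinite.f_integrable.
- by move=> x /=; rewrite fine_ge0 ?Radon_Nikodym_SigmaFinite.f_ge0.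
- move=> A mA; rewrite (Radon_Nikodym_SigmaFinite.f_integral numu mA).
  by apply: eq_integral => x _ /=; rewrite fineK.
Qed.

Section approximate_transitivity.
Context d (Y : measurableType d) (R : realType).
Variable mu : {measure set Y -> \bar R}.
Local Open Scope ereal_scope.

Definition L1plus : set (Y -> R) :=
  [set f | f \in Lfun mu 1 /\ forall y, (0 <= f y)%R].

Definition beta (a : automorphism Y) (f : Y -> R) : Y -> R :=
  fun y => (f (aut_inv a y) * rn_cocycle mu (aut_inv a) y)%R.

Definition approximately_transitive (G : Type) (alpha : G -> automorphism Y) :=
  forall (n : nat) (f : 'I_n -> Y -> R) (eps : R),
    (forall j, L1plus (f j)) -> (0 < eps)%R ->
  exists f0 : Y -> R, L1plus f0 /\
  exists (m : nat) (g : 'I_m -> G) (lam : 'I_n -> 'I_m -> R),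
    (forall j k, (0 <= lam j k)%R) /\
    forall j, 'N[mu]_1[(fun y =>
      (f j y - \sum_(k < m) lam j k * beta (alpha (g k)) f0 y)%R%:E)] <= eps%:E.

End approximate_transitivity.

(* e^u du *)
Definition exp_measure (R : realType) : set (measurableTypeR R) -> \bar R :=
  fun A => (\int[lebesgue_measure]_(u in A) (expR u)%:E)%E.

Section exp_measure.
Context {R : realType}.
Local Open Scope ereal_scope.

Let exp_measure0 : exp_measure (R := R) set0 = 0.
Proof. by rewrite /exp_measure integral_set0. Qed.

Let exp_measure_ge0 A : 0 <= exp_measure (R := R) A.
Proof. by apply: integral_ge0 => u _; rewrite lee_fin expR_ge0. Qed.

Let measurable_EFin_expR (A : set (measurableTypeR R)) :
  measurable_fun A (fun u : measurableTypeR R => (expR u)%:E).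
Proof.
by apply/measurable_EFinP; apply: measurable_funTS; exact: measurable_expR.
Qed.

Let exp_measure_sigma_additive : semi_sigma_additive (exp_measure (R := R)).
Proof.
move=> /= F mF tF mUF; rewrite /exp_measure; apply: cvg_toP.
  apply: ereal_nondecreasing_is_cvgn => m n mn.
  apply: lee_sum_nneg_natr => // k _ _; apply: integral_ge0 => /= x Fkx.
  by rewrite lee_fin expR_ge0.
by rewrite ge0_integral_bigcup//= => x _; rewrite lee_fin expR_ge0.
Qed.

HB.instance Definition _ := isMeasure.Build _ (measurableTypeR R) R
  (@exp_measure R) exp_measure0 exp_measure_ge0 exp_measure_sigma_additive.

Let exp_measure_sigma_finite : sigma_finite setT (@exp_measure R).
Proof.
exists (fun n : nat => `[(- n%:R)%R, n%:R]%classic).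
  apply/esym; rewrite -subTset => x _ /=.
  exists (Num.truncn `|x|).+1 => //=.
  by rewrite in_itv/= -ler_norml ltW// truncnS_gt.
move=> n; split; first exact: measurable_itv.
apply: (@le_lt_trans _ _
  (\int[lebesgue_measure]_(u in `[(- n%:R)%R, n%:R]) (expR n%:R)%:E)).
  apply: ge0_le_integral => //= u.
  by rewrite in_itv/= lee_fin ler_expR => /andP[].
rewrite integral_cst//= lebesgue_measure_itv/=; case: ifP => _.
  by rewrite -EFinD -EFinM ltry.
by rewrite mule0 ltry.
Qed.

HB.instance Definition _ := @Measure_isSigmaFinite.Build _ (measurableTypeR R) R
  (@exp_measure R) exp_measure_sigma_finite.

End exp_measure.

(* Borel isomorphic to a Borel subset of the line *)
Definition standard_borel (R : realType) d (T : measurableType d) :=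
  exists phi : T -> measurableTypeR R,
    [/\ measurable_fun setT phi, injective phi &
      forall A, measurable A -> measurable (phi @` A)].

Section flow.
Context (R : realType) d (Z : measurableType d).
Variable mu : {measure set Z -> \bar R}.

Definition is_flow (F : R -> automorphism Z) :=
  [/\ (forall z, F 0 z = z),
      (forall s t z, F (s + t) z = F s (F t z)),
      measurable_fun setT (fun p : measurableTypeR R * Z => F p.1 p.2) &
      forall s, nonsingular mu (F s)].

End flow.

Section associated_flow.
Context (R : realType) d (X : measurableType d).
Variable nu : {sigma_finite_measure set X -> \bar R}.
Variables (G : Type) (act : G -> automorphism X).

Definition gamma (g : G) (w : X * measurableTypeR R) : X * measurableTypeR R :=
  (act g w.1, w.2 - ln (rn_cocycle nu (act g) w.1)).

Definition rho (s : R) (w : X * measurableTypeR R) : X * measurableTypeR R :=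
  (w.1, w.2 + s).

Local Notation m := (nu \x @exp_measure R)%E.

(* [is_associated_flow mu F]: the flow [F] on the Lebesgue space [(Z, mu)] is a
   realization of the Mackey range of the Radon-Nikodym cocycle.  The space [Z]
   of the ergodic decomposition of [gamma] comes with its quotient map [p],
   which carries the class of [m] to the class of [mu], identifies
   [L^oo(Z, mu)] with the [gamma]-invariant part of [L^oo(m)], and intertwines
   [rho] and [F]. *)
Definition is_associated_flow dZ (Z : measurableType dZ)
    (mu : {sigma_finite_measure set Z -> \bar R}) (F : R -> automorphism Z) :=
  [/\ standard_borel R Z, is_flow mu F &
  exists p : X * measurableTypeR R -> Z,
    [/\ measurable_fun setT p,
        (forall A, measurable A -> mu A = 0%E <-> m (p @^-1` A) = 0%E),
        (forall f : X * measurableTypeR R -> R, f \in Lfun m +oo%E ->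
          (forall g, {ae m, forall w, f (gamma g w) = f w}) <->
          (exists2 h : Z -> R, h \in Lfun mu +oo%E &
            {ae m, forall w, f w = h (p w)})) &
        forall s, {ae m, forall w, p (rho s w) = F s (p w)}]].

End associated_flow.

Section sequence_space.

Definition coordinate_sets : set (set (nat -> bool)) :=
  [set A | exists (i : nat) (B : set bool), A = [set x | B (x i)]].

(* prod_{k >= 1} {0, 1} with its product sigma-algebra; the coordinate of index
   [k >= 1] is [x k.-1], and [false], [true] stand for 0, 1 *)
Definition bitseqs := g_sigma_algebraType coordinate_sets.

End sequence_space.

Record finperm := FinPerm {
  finperm_fun :> nat -> nat;
  finperm_inv : nat -> nat;
  finperm_funK : cancel finperm_fun finperm_inv;
  finperm_invK : cancel finperm_inv finperm_fun;
  finperm_finite : exists k, forall i, (k <= i)%N -> finperm_fun i = i }.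

Section natural_action.

Lemma measurable_reindex (s : nat -> nat) :
  measurable_fun setT (fun x : bitseqs => (fun i => x (s i)) : bitseqs).
Proof.
apply: (@measurability _ _ bitseqs bitseqs _ _ coordinate_sets) => //.
move=> _ [_ [i [B ->]] <-]; rewrite setTI.
by apply: sub_sigma_algebra; exists (s i), B.
Qed.

Lemma reindexK (s t : nat -> nat) : cancel s t ->
  cancel (fun x : bitseqs => (fun i => x (t i)) : bitseqs)
         (fun x : bitseqs => (fun i => x (s i)) : bitseqs).
Proof. by move=> st x; apply/funext => i; rewrite st. Qed.

Definition natural_action (s : finperm) : automorphism bitseqs :=
  Automorphism (reindexK (finperm_invK s)) (reindexK (finperm_funK s))
    (measurable_reindex s) (measurable_reindex (finperm_inv s)).

End natural_action.

Section product_measure.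
Context {R : realType}.

Definition nu_ (lam : R) : probability bool R :=
  bernoulli_prob (lam / (1 + lam)).

Lemma nu_E (lam : R) : 0 < lam ->
  nu_ lam [set false] = (1 / (1 + lam))%:E /\
  nu_ lam [set true] = (lam / (1 + lam))%:E.
Proof.
move=> l0; have l1 : 0 < 1 + lam by rewrite addr_gt0.
have p01 : 0 <= lam / (1 + lam) <= 1.
  by rewrite divr_ge0 ?(ltW l0) ?(ltW l1)// ler_pdivrMr// mul1r lerDr ler01.
rewrite /nu_ /= /bernoulli_prob p01 !fsbig_set1/=; split => //.
congr EFin; apply/eqP; rewrite subr_eq -mulrDl divff//.
by rewrite gt_eqF.
Qed.

(* [psum L n] is k_n; the sequences are indexed from 0, so that [L n] and
   [lam n] stand for L_{n+1} and lambda_{n+1} *)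
Definition psum (L : nat -> nat) (n : nat) := (\sum_(j < n) L j)%N.

(* index of the block containing the coordinate [i]; when all [L n] are
   positive, it is at most [i] *)
Definition block (L : nat -> nat) (i : nat) :=
  find (fun n => i < psum L n.+1)%N (iota 0 i.+1).

Lemma blockP (L : nat -> nat) (n i : nat) : (forall n, 0 < L n)%N ->
  (psum L n <= i < psum L n.+1)%N -> block L i = n.
Proof.
move=> L0 /andP[ni iSn].
have mono a b : (a <= b)%N -> (psum L a <= psum L b)%N.
  move=> /subnKC <-; elim: (b - a)%N => [|c ih]; first by rewrite addn0.
  by rewrite addnS /psum big_ord_recr/= (leq_trans ih)// leq_addr.
have ge a : (a <= psum L a)%N.
  elim: a => // a ih; rewrite /psum big_ord_recr/= -addn1.
  by rewrite leq_add.
have nle : (n <= i)%N by rewrite (leq_trans (ge n)).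
have H : has (fun n => i < psum L n.+1)%N (iota 0 i.+1).
  by apply/hasP; exists n => //; rewrite mem_iota add0n ltnS.
rewrite /block; set k := find _ _.
have ki : (k < i.+1)%N by rewrite -[X in (_ < X)%N](size_iota 0) -has_find.
apply/eqP; rewrite eqn_leq; apply/andP; split; rewrite leqNgt; apply/negP => hk.
  have := before_find 0%N hk; rewrite nth_iota ?add0n ?iSn//.
have := nth_find 0%N H; rewrite nth_iota// add0n => /leq_trans/(_ (mono _ _ hk)).
by rewrite ltnNge ni.
Qed.

Definition is_product_measure (q : nat -> probability bool R)
    (nu : probability bitseqs R) :=
  forall (n : nat) (B : nat -> set bool),
    nu [set x | forall i, (i < n)%N -> B i (x i)] =
    (\prod_(i < n) q i (B i))%E.

(* nu = nu(L_n, lambda_n) *)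
Definition is_nu (L : nat -> nat) (lam : nat -> R) :=
  is_product_measure (fun i => nu_ (lam (block L i))).

End product_measure.

(* Main.v *)
(** Let [W = X x R] carry [nu x Leb], which has the null sets of
[nu x e^u du], and let [Q] be a [gamma]-invariant subset of [W].  Let [C_a] be
the cylinder of the sequences that start with the word [a].  Exchanging a 1 at
a coordinate [l] with a 0 at a coordinate [j] multiplies [nu] by
[lambda_j / lambda_l], so that [gamma] also translates the real coordinate by
[ln (lambda_l / lambda_j)].  Average over all the [j] of a distant block with
[M] coordinates and parameter [lambda]: the number of zeros of the block appears
on one side and its number of ones on the other.  If [M lambda] is large, both
are close to their means by Chebyshev's inequality.  Hence, seen from invariant
sets, [C_a x [0, delta[] is close to a multiple of a translate of
[C_a' x [0, delta[], where [a'] is [a] with the 1 at [l] erased; by induction it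
is close to a multiple of a translate of [C_0 x [0, delta[], with [C_0] given by
the zero word.

Combinations of the indicators of dyadic cells are dense in [L^1(W)].  So every
function in [L^1_+(W)] is close, on invariant sets, to a nonnegative combination
of translates of the indicator of a single [C_0 x [0, 2^-N[].  Push forward
along [W -> Z]: the functions [f_j] on [Z] lift to [W], and the image of that
indicator is the required [f]. *)

Require Import Defs.
From HB Require Import structures.
From mathcomp Require Import all_boot all_order all_algebra.
From mathcomp Require Import all_classical all_reals all_analysis.
From mathcomp Require Import measurable_realfun ring lra zify.
Set Implicit Arguments.
Unset Strict Implicit.
Unset Printing Implicit Defensive.
Import Order.TTheory GRing.Theory Num.Theory.
Import numFieldNormedType.Exports.
Local Open Scope classical_set_scope.
Local Open Scope ring_scope.

(** * Exchanging two coordinates of a product measure *)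

(** The translation and the coefficient found for a cell depend on the cell and on the tolerance,
    never on [Q]. This uniformity carries the argument: preimages under [p] of measurable sets [P]
    are invariant, and control of the integrals over all [P] at once is control in L^1(Z), without
    conditional expectations on an infinite measure space. Lebesgue measure is preferred to e^u du
    because [rho] preserves it. Word length and dyadic scale are the same [N], and approximations
    are required for all large [N], so that one slab serves all the [f_j].

    The average stays inside one block because all its [j] yield the same translation. Put p =
    lambda / (1 + lambda), which is at most 1/2: the mean numbers of ones and zeros, M p and M (1 -
    p), are both at least M p, while the deviation is of order sqrt(M p). The relative error 1 /
    sqrt(M p) is where the unboundedness of L_n lambda_n enters.

    A function of Z composed with [p] is in general not integrable on W. The lift therefore goes
    through the finite measure nu x (normal law), which has the same null sets, and its image on
    Z. *)

Section pushforward_measure.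
Context d d' (T1 : measurableType d) (T2 : measurableType d') (R : realType).
Variables (m : {measure set T1 -> \bar R}) (f : T1 -> T2).
Hypothesis mf : measurable_fun setT f.

Definition pushforward_measure : {measure set T2 -> \bar R} :=
  @measure_function_pushforward__canonical__measure_function_Measure
    _ _ _ _ _ m f mf.

End pushforward_measure.

Section cylinders.
Context {R : realType}.

Definition cyl (n : nat) (B : nat -> set bool) : set bitseqs :=
  [set x | forall i, (i < n)%N -> B i (x i)].

Lemma measurable_coord (i : nat) (B : set bool) :
  measurable ([set x | B (x i)] : set bitseqs).
Proof. by apply: sub_sigma_algebra; exists i, B. Qed.

Lemma cyl_bigcap n B :
  cyl n B = \bigcap_(i in `I_n) ([set x | B i (x i)] : set bitseqs).
Proof. by []. Qed.

Lemma measurable_cyl n B : measurable (cyl n B).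
Proof.
rewrite cyl_bigcap; apply: bigcap_measurableType => i _.
exact: measurable_coord.
Qed.

(** Cylinders of length at least [n0] are stable under intersection and still generate, since a
    coordinate set is also a longer cylinder. The threshold lets [nu_swap] assume that both
    exchanged coordinates lie inside. *)
Lemma cylinder_measure_unique (n0 : nat) (m1 m2 : {measure set bitseqs -> \bar R}) :
  (m1 setT < +oo)%E ->
  (forall n B, (n0 <= n)%N -> m1 (cyl n B) = m2 (cyl n B)) ->
  forall A, measurable A -> m1 A = m2 A.
Proof.
move=> m1oo m12 A mA.
pose G : set (set bitseqs) :=
  [set C | exists n B, (n0 <= n)%N /\ C = cyl n B].
have GT : G setT.
  by exists n0, (fun=> setT); split => //; apply/seteqP; split.
apply: (@measure_unique _ _ bitseqs G (fun=> setT)) => //.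
- apply/seteqP; split.
    apply: smallest_sub; first exact: smallest_sigma_algebra.
    move=> _ [i [B ->]]; apply: sub_sigma_algebra.
    exists (maxn n0 i.+1), (fun k => if k == i then B else setT).
    split; first exact: leq_maxl.
    apply/seteqP; split => [x /= Bx k _|x /= /(_ i)].
      by case: eqP => // ->.
    by rewrite eqxx; apply; rewrite leq_maxr.
  apply: smallest_sub; first exact: sigma_algebra_measurable.
  by move=> _ [n [B [_ ->]]]; exact: measurable_cyl.
- move=> _ _ [n [B [n0n ->]]] [m [C [n0m ->]]].
  exists (maxn n m), (fun i => (if (i < n)%N then B i else setT) `&`
     (if (i < m)%N then C i else setT)).
  split; first by rewrite (leq_trans n0n)// leq_maxl.
  apply/seteqP; split => [x [Bx Cx] i _|x /= H].
    by split; case: ifP => // ?; [exact: Bx|exact: Cx].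
  split => i im.
    have /H : (i < maxn n m)%N by rewrite (leq_trans im)// leq_maxl.
    by rewrite im => -[].
  have /H : (i < maxn n m)%N by rewrite (leq_trans im)// leq_maxr.
  by rewrite im => -[].
- by apply/seteqP; split => // x _; exists 0%N.
- by move=> _ [n [B [n0n ->]]]; exact: m12.
Qed.

End cylinders.

Section swap.

Definition swapn (l j i : nat) : nat :=
  if i == l then j else if i == j then l else i.

Lemma swapnl l j : swapn l j l = j.
Proof. by rewrite /swapn eqxx. Qed.

Lemma swapnr l j : swapn l j j = l.
Proof. by rewrite /swapn eqxx; case: eqP. Qed.

Lemma swapn_id l j i : i != l -> i != j -> swapn l j i = i.
Proof. by rewrite /swapn => /negPf -> /negPf ->. Qed.

Lemma swapnK l j : involutive (swapn l j).
Proof.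
move=> i; have [->|il] := eqVneq i l; first by rewrite swapnl swapnr.
have [->|ij] := eqVneq i j; first by rewrite swapnr swapnl.
by rewrite !swapn_id.
Qed.

Lemma swapn_finite l j : exists k, forall i, (k <= i)%N -> swapn l j i = i.
Proof.
exists (maxn l j).+1 => i; rewrite gtn_max => /andP[li ji].
by rewrite swapn_id// gtn_eqF.
Qed.

Definition swap_perm l j : finperm :=
  FinPerm (swapnK l j) (swapnK l j) (swapn_finite l j).

Definition swap l j (x : bitseqs) : bitseqs := fun i => x (swapn l j i).

Lemma measurable_swap l j : measurable_fun setT (swap l j).
Proof. exact: measurable_reindex. Qed.

Lemma swapK l j : involutive (swap l j).
Proof. by move=> x; apply/funext => i; rewrite /swap swapnK. Qed.

End swap.

Section product_measure_swap.
Context {R : realType} (q : nat -> probability bool R).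
Variable nu : probability bitseqs R.
Hypothesis nuP : is_product_measure q nu.

Definition pr (i : nat) (b : bool) : R := fine (q i [set b]).

Lemma prE i b : q i [set b] = (pr i b)%:E.
Proof. by rewrite /pr fineK// fin_num_measure. Qed.

Lemma prI i b (B : set bool) :
  q i (B `&` [set b]) = ((b \in B)%:R * pr i b)%:E.
Proof.
have [/set_mem bB|/negP bB] := boolP (b \in B).
  rewrite mul1r -prE; congr (q i _).
  by apply/seteqP; split => [x []|x /= ->].
rewrite mul0r (_ : _ `&` _ = set0) ?measure0//.
by apply/seteqP; split => // x [/= Bx xb]; apply: bB; rewrite -xb inE.
Qed.

Definition bits (l j : nat) (a b : bool) : set bitseqs :=
  [set x | x l = a /\ x j = b].

Lemma measurable_bits l j a b : measurable (bits l j a b).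
Proof.
have -> : bits l j a b = [set x | [set a] (x l)] `&` [set x | [set b] (x j)].
  by [].
by apply: measurableI; exact: measurable_coord.
Qed.

Definition cyl2 l j a b (B : nat -> set bool) (i : nat) : set bool :=
  B i `&` (if i == l then [set a] else if i == j then [set b] else setT).

Lemma cyl2E n l j a b B : (l < n)%N -> (j < n)%N -> l != j ->
  cyl n B `&` bits l j a b = cyl n (cyl2 l j a b B).
Proof.
move=> ln jn lj; apply/seteqP; split => x.
  move=> [Bx [xl xj]] i i_n; split; first exact: Bx.
  by case: eqP => [->//|_]; case: eqP => [->|].
move=> /= H; split; first by move=> i /H [].
split; first by have [_] := H _ ln; rewrite eqxx.
by have [_] := H _ jn; rewrite eqxx eq_sym (negPf lj).
Qed.

Lemma nu_cyl2 n l j a b B : (l < n)%N -> (j < n)%N -> l != j ->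
  nu (cyl n B `&` bits l j a b) =
  (((a \in B l)%:R * pr l a)%:E * (((b \in B j)%:R * pr j b)%:E *
   \prod_(i < n | (val i != l) && (val i != j)) q i (B i)))%E.
Proof.
move=> ln jn lj; rewrite cyl2E// [LHS]nuP.
rewrite (bigD1 (Ordinal ln))//= (bigD1 (Ordinal jn))/=; last first.
  by rewrite eq_sym.
rewrite /cyl2 eqxx prI (eq_sym j) (negPf lj) eqxx prI.
congr (_ * (_ * _))%E; apply: eq_big => [i|i /andP[il ij]].
  by rewrite -!val_eqE.
by rewrite -!val_eqE/= in il ij *; rewrite (negPf il) (negPf ij) setIT.
Qed.

Lemma swap_cyl n l j B : (l < n)%N -> (j < n)%N ->
  swap l j @^-1` cyl n B = cyl n (fun i => B (swapn l j i)).
Proof.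
move=> ln jn.
have sn i : (i < n)%N -> (swapn l j i < n)%N.
  by rewrite /swapn; case: eqP => // _; case: eqP.
apply/seteqP; split => x /= H i i_n.
  by have := H _ (sn _ i_n); rewrite /swap swapnK.
by have := H _ (sn _ i_n); rewrite swapnK.
Qed.

Lemma swap_bits l j a b : swap l j @^-1` bits l j a b = bits l j b a.
Proof.
by apply/seteqP; split => x; rewrite /bits/= /swap swapnl swapnr => -[].
Qed.

(** Both sides are finite measures in [A]. On a cylinder long enough to contain [l] and [j] they
    differ only by the order of the factors at these two coordinates. The cross-multiplied form also
    makes sense for zero weights. *)
Lemma nu_swap l j a b A : l != j -> measurable A ->
  ((pr l a * pr j b)%:E * nu (swap l j @^-1` A `&` bits l j b a) =
  (pr l b * pr j a)%:E * nu (A `&` bits l j a b))%E.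
Proof.
move=> lj mA.
have pr_ge0 i c : 0 <= pr i c by rewrite fine_ge0.
have mrest (m : {measure set bitseqs -> \bar R}) (k : R) D : 0 <= k ->
    measurable D -> {m' : {measure set bitseqs -> \bar R} |
      forall C, m' C = (k%:E * m (C `&` D))%E}.
  move=> k0 mD.
  by exists (mscale (NngNum k0) (mrestr m mD) : {measure set _ -> \bar R}).
have [m1 m1E] := mrest (pushforward_measure nu (measurable_swap l j)) _ _
  (mulr_ge0 (pr_ge0 l a) (pr_ge0 j b)) (measurable_bits l j a b).
have [m2 m2E] := mrest nu _ _
  (mulr_ge0 (pr_ge0 l b) (pr_ge0 j a)) (measurable_bits l j a b).
have {}m2E C : (m2 C = (pr l b * pr j a)%:E * nu (C `&` bits l j a b))%E.
  exact: m2E.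
have H C : ((pr l a * pr j b)%:E * nu (swap l j @^-1` C `&` bits l j b a)
    = m1 C)%E.
  rewrite m1E -[pushforward_measure _ _ _]/(nu (swap l j @^-1` (C `&` bits l j a b))).
  by rewrite preimage_setI swap_bits.
rewrite H -m2E; apply: (@cylinder_measure_unique _ (maxn l j).+1) => //.
  rewrite -H preimage_setT setTI lte_mul_pinfty// ?lee_fin ?mulr_ge0//.
  by rewrite (le_lt_trans (probability_le1 _ _)) ?ltry//; exact: measurable_bits.
move=> n B; rewrite gtn_max => /andP[ln jn].
rewrite -H m2E swap_cyl// !nu_cyl2// swapnl swapnr.
have -> : (\prod_(i < n | (val i != l) && (val i != j)) q i (B (swapn l j i)) =
    \prod_(i < n | (val i != l) && (val i != j)) q i (B i))%E.
  by apply: eq_bigr => i /andP[il ij]; rewrite swapn_id.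
rewrite !muleA -!EFinM; congr (_%:E * _)%E; ring.
Qed.

End product_measure_swap.

(** * Erasing a word by means of a distant block *)

Section bounded_measurable.
Context d (T : measurableType d) (R : realType) (P : probability T R).
Implicit Types f g : T -> R.

(** A class stable under the algebraic operations and integrable for a probability: it settles the
    integrability side conditions of all the expectations below. *)
Definition bounded_measurable f :=
  measurable_fun setT f /\ exists K, forall x, `|f x| <= K.

Lemma bounded_measurable_integrable f : bounded_measurable f ->
  P.-integrable setT (EFin \o f).
Proof.
move=> [mf [K fK]]; apply: measurable_bounded_integrable => //.
  by rewrite (le_lt_trans (probability_le1 P measurableT)) ?ltry.
exists K; split; first exact: num_real.
by move=> M KM x _; rewrite /= (le_trans (fK x))// ltW.
Qed.

Lemma bounded_measurable_cst (c : R) : bounded_measurable (fun=> c).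
Proof. by split => //; exists `|c|. Qed.

Lemma bounded_measurableD f g : bounded_measurable f -> bounded_measurable g ->
  bounded_measurable (fun x => f x + g x).
Proof.
move=> [mf [K fK]] [mg [M gM]]; split; first exact: measurable_funD.
by exists (K + M) => x; rewrite (le_trans (ler_normD _ _))// lerD.
Qed.

Lemma bounded_measurableM f g : bounded_measurable f -> bounded_measurable g ->
  bounded_measurable (fun x => f x * g x).
Proof.
move=> [mf [K fK]] [mg [M gM]]; split; first exact: measurable_funM.
by exists (K * M) => x; rewrite normrM ler_pM.
Qed.

Lemma bounded_measurableN f : bounded_measurable f ->
  bounded_measurable (fun x => - f x).
Proof.
move=> [mf [K fK]]; split; first exact: measurableT_comp.
by exists K => x; rewrite normrN.
Qed.

Lemma bounded_measurableB f g : bounded_measurable f -> bounded_measurable g ->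
  bounded_measurable (fun x => f x - g x).
Proof.
by move=> bf bg; apply: bounded_measurableD => //; exact: bounded_measurableN.
Qed.

Lemma bounded_measurable_norm f : bounded_measurable f ->
  bounded_measurable (fun x => `|f x|).
Proof.
move=> [mf [K fK]]; split; first exact: measurableT_comp.
by exists K => x; rewrite normr_id.
Qed.

Lemma bounded_measurable_sum (I : Type) (s : seq I) (F : I -> T -> R) :
  (forall i, bounded_measurable (F i)) ->
  bounded_measurable (fun x => \sum_(i <- s) F i x).
Proof.
move=> bF; elim: s => [|i s ih].
  rewrite (_ : (fun _ => _) = fun=> 0); first exact: bounded_measurable_cst.
  by apply/funext => x; rewrite big_nil.
rewrite (_ : (fun _ => _) = fun x => F i x + \sum_(j <- s) F j x).
  exact: bounded_measurableD.
by apply/funext => x; rewrite big_cons.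
Qed.

Lemma bounded_measurable_indic (A : set T) : measurable A ->
  bounded_measurable (\1_A : T -> R).
Proof.
move=> mA; split => //; exists 1 => x.
by rewrite ger0_norm indicE ?ler0n ?lern1 ?leq_b1.
Qed.

Lemma RintegralT_cst (c : R) : \int[P]_x c = c.
Proof.
rewrite Rintegral_cst// -[RHS]mulr1; congr (_ * _).
exact: (congr1 fine (probability_setT P)).
Qed.

Lemma RintegralT_sum (I : Type) (s : seq I) (F : I -> T -> R) :
  (forall i, bounded_measurable (F i)) ->
  \int[P]_x (\sum_(i <- s) F i x) = \sum_(i <- s) \int[P]_x F i x.
Proof.
move=> bF; elim: s => [|i s ih].
  by under eq_Rintegral do rewrite big_nil; rewrite big_nil Rintegral_cst// mul0r.
under eq_Rintegral do rewrite big_cons.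
rewrite big_cons -ih RintegralD//; apply: bounded_measurable_integrable => //.
exact: bounded_measurable_sum.
Qed.

Lemma Rintegral_indic (A : set T) (f : T -> R) :
  \int[P]_x (\1_A x * f x) = \int[P]_(x in A) f x.
Proof.
rewrite [RHS]Rintegral_mkcond; apply: eq_Rintegral => x _.
by rewrite patchE indicE; case: ifP; rewrite (mul1r, mul0r).
Qed.

Lemma norm_RintegralT_le f g : bounded_measurable f -> bounded_measurable g ->
  (forall x, `|f x| <= g x) -> `|\int[P]_x f x| <= \int[P]_x g x.
Proof.
move=> bf bg fg; apply: (le_trans (le_normr_Rintegral measurableT _)).
  exact: bounded_measurable_integrable.
apply: le_Rintegral => //; apply: bounded_measurable_integrable => //.
exact: bounded_measurable_norm.
Qed.

End bounded_measurable.

Section block_count.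
Context {R : realType} (q : nat -> probability bool R).
Variable nu : probability bitseqs R.
Hypothesis nuP : is_product_measure q nu.
Local Notation pr := (pr q).

Lemma nu_coord (i : nat) (b : bool) :
  nu [set x : bitseqs | x i = b] = (pr i b)%:E.
Proof.
have -> : [set x : bitseqs | x i = b] =
    cyl i.+1 (fun k => if k == i then [set b] else setT).
  apply/seteqP; split => [x /= xi k _|x /= /(_ i)].
    by case: eqP => // ->.
  by rewrite eqxx; apply.
rewrite nuP big_ord_recr/= eqxx big1 ?mul1e ?prE// => k _.
by rewrite ltn_eqF// probability_setT.
Qed.

Lemma nu_bits l j a b : l != j -> nu (bits l j a b) = (pr l a * pr j b)%:E.
Proof.
move=> lj; pose n := (maxn l j).+1.
have := nu_cyl2 nuP a b (fun=> setT) (leq_maxl l j : l < n)%N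
  (leq_maxr l j : j < n)%N lj.
rewrite !in_setT !mul1r (_ : cyl n _ = setT); last first.
  by apply/seteqP; split.
rewrite setTI => ->; rewrite big1 ?mule1 ?EFinM// => i _.
by rewrite probability_setT.
Qed.

Lemma bounded_measurable_bit i :
  bounded_measurable (fun x : bitseqs => (x i)%:R : R).
Proof.
have -> : (fun x : bitseqs => (x i)%:R : R) = \1_[set x : bitseqs | [set true] (x i)].
  apply/funext => x; rewrite indicE; congr (nat_of_bool _)%:R.
  by apply/idP/idP => [xi|/set_mem//]; apply/mem_set.
apply: bounded_measurable_indic; exact: (measurable_coord i [set true]).
Qed.

Lemma Rintegral_bit i : \int[nu]_x (x i)%:R = pr i true.
Proof.
transitivity (\int[nu]_x (\1_[set x : bitseqs | x i = true] x * 1)).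
  apply: eq_Rintegral => x _; rewrite mulr1 indicE; congr (nat_of_bool _)%:R.
  by apply/idP/idP => [xi|/set_mem//]; apply/mem_set.
rewrite Rintegral_indic Rintegral_cst; last exact: (measurable_coord i [set true]).
by rewrite mul1r; exact: (congr1 fine (nu_coord i true)).
Qed.

Lemma Rintegral_bitM i j : i != j ->
  \int[nu]_x ((x i)%:R * (x j)%:R) = pr i true * pr j true.
Proof.
move=> ij.
transitivity (\int[nu]_x (\1_(bits i j true true) x * 1)).
  apply: eq_Rintegral => x _; rewrite mulr1 indicE -natrM mulnb.
  congr (nat_of_bool _)%:R.
  by apply/idP/idP => [/andP[xi xj]|/set_mem[/= -> ->]//]; apply/mem_set.
rewrite Rintegral_indic Rintegral_cst; last exact: measurable_bits.
by rewrite mul1r; exact: (congr1 fine (nu_bits true true ij)).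
Qed.

Variables (M : nat) (js : 'I_M -> nat) (p : R).
Hypotheses (js_inj : injective js) (js_pr : forall m, pr (js m) true = p).

Definition count_ones (x : bitseqs) : R := \sum_m (x (js m))%:R.

Lemma bounded_measurable_count_ones : bounded_measurable count_ones.
Proof.
by apply: bounded_measurable_sum => m; exact: bounded_measurable_bit.
Qed.

(** Expand the square: distinct coordinates are independent, so only the diagonal terms survive,
    each being the variance of one bit. *)
Lemma variance_count_ones :
  \int[nu]_x (count_ones x - M%:R * p) ^+ 2 = M%:R * (p * (1 - p)).
Proof.
have bX m : bounded_measurable (fun x : bitseqs => (x (js m))%:R - p).
  apply: bounded_measurableB; first exact: bounded_measurable_bit.
  exact: bounded_measurable_cst.
have intX m m' : \int[nu]_x (((x (js m))%:R - p) * ((x (js m'))%:R - p)) =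
    if m == m' then p * (1 - p) else 0.
  transitivity (\int[nu]_x ((x (js m))%:R * (x (js m'))%:R
      - (p * (x (js m))%:R + p * (x (js m'))%:R) + p ^+ 2)).
    by apply: eq_Rintegral => x _; ring.
  have b1 : bounded_measurable (fun x : bitseqs =>
      (x (js m))%:R * (x (js m'))%:R : R).
    by apply: bounded_measurableM; exact: bounded_measurable_bit.
  have b2 k : bounded_measurable (fun x : bitseqs => p * (x (js k))%:R).
    apply: bounded_measurableM; last exact: bounded_measurable_bit.
    exact: bounded_measurable_cst.
  have b3 := bounded_measurableD (b2 m) (b2 m').
  have bi := fun f b => @bounded_measurable_integrable _ _ _ nu f b.
  rewrite RintegralD//; [|apply: bi|apply: bi]; last 2 first.
  - exact: bounded_measurableB.
  - exact: bounded_measurable_cst.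
  rewrite RintegralB//; [|exact: bi..].
  rewrite RintegralD//; [|exact: bi..].
  rewrite !(RintegralZl _ measurableT (bi _ (bounded_measurable_bit _))).
  rewrite RintegralT_cst !Rintegral_bit !js_pr.
  case: eqP => [<-|/eqP mm']; last first.
    by rewrite Rintegral_bitM ?(inj_eq js_inj)// !js_pr; ring.
  under eq_Rintegral do rewrite -natrM mulnb andbb.
  by rewrite Rintegral_bit js_pr; ring.
transitivity (\int[nu]_x (\sum_m \sum_m' ((x (js m))%:R - p) * ((x (js m'))%:R - p))).
  apply: eq_Rintegral => x _; rewrite /count_ones.
  have -> : M%:R * p = \sum_(m < M) p by rewrite sumr_const card_ord mulr_natl.
  rewrite -sumrB expr2 mulr_suml.
  by apply: eq_bigr => m _; rewrite mulr_sumr.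
have bXX m m' : bounded_measurable (fun x : bitseqs =>
   ((x (js m))%:R - p) * ((x (js m'))%:R - p)) by exact: bounded_measurableM.
rewrite RintegralT_sum; last by move=> m; exact: bounded_measurable_sum.
rewrite (eq_bigr (fun=> p * (1 - p))) => [|m _]; last first.
  rewrite RintegralT_sum//; under eq_bigr do rewrite intX.
  by rewrite -big_mkcond (big_pred1 m)// => m'; exact: eq_sym.
by rewrite sumr_const card_ord mulr_natl.
Qed.

(** Chebyshev's inequality in first-moment form. The parameter [eta] stays free; [flip_bit_approx]
    takes it proportional to the mean [M p]. *)
Lemma count_ones_deviation (eta : R) : 0 < eta ->
  \int[nu]_x `|count_ones x - M%:R * p| <=
  (eta + M%:R * (p * (1 - p)) / eta) / 2.
Proof.
move=> eta0.
have bY : bounded_measurable (fun x => count_ones x - M%:R * p).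
  apply: bounded_measurableB; first exact: bounded_measurable_count_ones.
  exact: bounded_measurable_cst.
have bY2 : bounded_measurable (fun x => (count_ones x - M%:R * p) ^+ 2).
  exact: bounded_measurableM.
have bi := fun f b => @bounded_measurable_integrable _ _ _ nu f b.
have bc := fun c => @bounded_measurable_cst _ bitseqs R c.
rewrite (_ : (_ + _) / 2 = \int[nu]_x
    ((eta + (count_ones x - M%:R * p) ^+ 2 * eta^-1) * 2^-1)); last first.
  rewrite RintegralZr//; last first.
    by apply/bi/bounded_measurableD => //; exact: bounded_measurableM.
  rewrite RintegralD//; [|exact: bi|by apply/bi/bounded_measurableM].
  rewrite RintegralZr//; last exact: bi.
  by rewrite variance_count_ones RintegralT_cst.
apply: le_Rintegral => //; first exact/bi/bounded_measurable_norm.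
  apply/bi/bounded_measurableM => //; apply: bounded_measurableD => //.
  exact: bounded_measurableM.
move=> x _; set y := count_ones x - _.
(* AM-GM: [2 eta |y| <= eta ^ 2 + y ^ 2] *)
rewrite ler_pdivlMr// -(ler_pM2r eta0) mulrDl divfK ?gt_eqF//.
have -> : y ^+ 2 = `|y| ^+ 2 by rewrite real_normK ?num_real.
have : 0 <= (eta - `|y|) ^+ 2 by rewrite sqr_ge0.
by move=> ?; nra.
Qed.

End block_count.

Section swap_covariant.
Context {R : realType} (q : nat -> probability bool R).
Variable nu : probability bitseqs R.
Hypothesis nuP : is_product_measure q nu.
Local Notation pr := (pr q).
Hypothesis pr_gt0 : forall i b, 0 < pr i b.

(** For [nu_ lam] this is [lam] itself, see [block_odds]; the Radon-Nikodym derivatives of exchanges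
    are ratios of odds. *)
Definition odds (i : nat) : R := pr i true / pr i false.

Lemma odds_gt0 i : 0 < odds i.
Proof. by rewrite divr_gt0. Qed.

(** Integrated form of [nu_swap]: on [bits l j false true] the image of [nu] under the exchange is
    [odds l / odds j] times [nu]. *)
Lemma integral_swap l j (g : bitseqs -> R) : l != j ->
  bounded_measurable g -> (forall x, 0 <= g x) ->
  \int[nu]_(x in bits l j true false) g (swap l j x) =
  odds l / odds j * \int[nu]_(x in bits l j false true) g x.
Proof.
move=> lj bg g0; have [mg _] := bg.
have r0 : 0 <= odds l / odds j by rewrite ltW// divr_gt0// odds_gt0.
have mEg : measurable_fun setT (EFin \o g) by exact/measurable_EFinP.
transitivity (fine (\int[pushforward_measure nu (measurable_swap l j)]_(x in
    bits l j false true) (g x)%:E)%E).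
  congr fine; rewrite /pushforward_measure ge0_integral_pushforward//=.
  - by rewrite swap_bits.
  - exact: measurable_swap.
  - exact: measurable_bits.
  - exact: measurable_funTS.
  - by move=> x _; rewrite lee_fin.
rewrite (@eq_measure_integral _ _ _ _ (mscale (NngNum r0) nu)); last first.
  move=> A mA AE.
  rewrite -[RHS]/((odds l / odds j)%:E * nu A)%E -[pushforward_measure _ _ _]/(nu (swap l j @^-1` A)).
  have := nu_swap nuP false true lj mA.
  rewrite (setIidl AE) (_ : _ `&` _ = swap l j @^-1` A); last first.
    by apply/setIidl; rewrite -(swap_bits l j false true) => x /=; exact: AE.
  move=> H; have -> : odds l / odds j =
      (pr l false * pr j true)^-1 * (pr l true * pr j false).
    by rewrite /odds !invfM invrK; ring.
  rewrite EFinM -muleA -H muleA -EFinM mulVf ?mul1e//.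
  by rewrite gt_eqF// mulr_gt0.
rewrite ge0_integral_mscale//=.
- rewrite fineM//; apply: integrable_fin_num; first exact: measurable_bits.
  apply: (integrableS measurableT) => //; first exact: measurable_bits.
  exact: bounded_measurable_integrable.
- exact: measurable_bits.
- exact: measurable_funTS.
- by move=> x _; rewrite lee_fin.
Qed.

Definition prefix (k : nat) (a : nat -> bool) : set bitseqs :=
  [set x | forall i, (i < k)%N -> x i = a i].

Lemma measurable_prefix k a : measurable (prefix k a).
Proof. exact: (measurable_cyl k (fun i => [set a i])). Qed.

Definition clear_bit (l : nat) (a : nat -> bool) (i : nat) : bool :=
  if i == l then false else a i.

(** As [j] lies beyond the word, the exchange alters the word only at [l], where it brings the 0
    found at [j]. *)
Lemma swap_prefix k (a : nat -> bool) l j x : (l < k)%N -> (k <= j)%N -> a l ->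
  bits l j true false x ->
  (x \in prefix k a) = (swap l j x \in prefix k (clear_bit l a)).
Proof.
move=> lk kj al [xl xj].
apply/idP/idP => /set_mem H; apply/mem_set => i ik; have := H i ik;
  rewrite /swap /clear_bit; have [->|il] := eqVneq i l.
- by rewrite swapnl.
- by rewrite swapn_id// ltn_eqF// (leq_trans ik).
- by rewrite xl al.
- by rewrite swapn_id// ltn_eqF// (leq_trans ik).
Qed.

(* To be read with [v s x = Leb {t in [0, delta[ | (x, t + s) in Q}] for a
   [gamma]-invariant set [Q], see [crossing_time_covariant]. *)
Definition swap_covariant (delta : R) (v : R -> bitseqs -> R) :=
  [/\ forall s, measurable_fun setT (v s), forall s x, 0 <= v s x <= delta &
    forall l j s, l != j -> {ae nu, forall x, bits l j true false x ->
      v s x = v (s + ln (odds l / odds j)) (swap l j x)}].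

Lemma bounded_measurable_prefix delta v s k a : swap_covariant delta v ->
  bounded_measurable (fun x => \1_(prefix k a) x * v s x).
Proof.
move=> [mv vd _]; apply: bounded_measurableM.
  by apply: bounded_measurable_indic; exact: measurable_prefix.
split; first exact: mv.
by exists delta => x; have /andP[v0 vle] := vd s x; rewrite ger0_norm.
Qed.

(** The word [a] forces a 1 at [l] and the factor [1 - x j] a 0 at [j], so the left integrand lives
    on [bits l j true false], where the covariance of [v] and [integral_swap] apply. On the right,
    the cleared word and the factor [x j] single out [bits l j false true]. *)
Lemma integral_flip_bit delta v k (a : nat -> bool) l j s :
  swap_covariant delta v -> (l < k)%N -> (k <= j)%N -> a l ->
  \int[nu]_x (\1_(prefix k a) x * v s x * (1 - (x j)%:R)) =
  odds l / odds j * \int[nu]_x (\1_(prefix k (clear_bit l a)) x *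
     v (s + ln (odds l / odds j)) x * (x j)%:R).
Proof.
move=> cv lk kj al; have [mv vd vE] := cv.
have lj : l != j by rewrite ltn_eqF// (leq_trans lk).
set g := fun x => \1_(prefix k (clear_bit l a)) x * v (s + ln (odds l / odds j)) x.
have bg : bounded_measurable g by exact: bounded_measurable_prefix cv.
have g0 x : 0 <= g x by rewrite mulr_ge0//; have /andP[] := vd (s + ln (odds l / odds j)) x.
transitivity (\int[nu]_(x in bits l j true false) g (swap l j x)); last first.
  rewrite integral_swap//; congr (_ * _); rewrite -Rintegral_indic.
  apply: eq_Rintegral => x _; rewrite -/(g x) mulrC /g.
  have [/set_mem xp|xp] := boolP (x \in prefix k (clear_bit l a)); last first.
    by rewrite [\1_(prefix _ _) _]indicE (negPf xp) !mul0r.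
  congr (_ * _); rewrite indicE; congr (nat_of_bool _)%:R.
  apply/idP/idP => [/set_mem[]//|xj]; apply/mem_set; split => //.
  by rewrite xp// /clear_bit eqxx.
rewrite -[RHS]Rintegral_indic /Rintegral; congr fine.
have mf : measurable_fun setT (fun x => \1_(prefix k a) x * v s x * (1 - (x j)%:R)).
  apply: measurable_funM; first by have [] := bounded_measurable_prefix s k a cv.
  by apply: measurable_funB => //; have [] := @bounded_measurable_bit R j.
apply: ge0_ae_eq_integral => //.
- exact/measurable_EFinP.
- apply/measurable_EFinP; apply: measurable_funM.
    by apply: measurable_indic; exact: measurable_bits.
  by apply: measurableT_comp; [have [] := bg|exact: measurable_swap].
- move=> x _; rewrite lee_fin mulr_ge0//; last by case: (x j); rewrite ?subrr// subr0.
  by rewrite mulr_ge0//; have /andP[] := vd s x.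
- by move=> x _; rewrite lee_fin mulr_ge0.
apply: filterS (vE l j s lj) => x vx _; congr EFin.
have [/set_mem xb|xb] := boolP (x \in bits l j true false); last first.
  rewrite [\1_(bits _ _ _ _) _]indicE (negPf xb) mul0r.
  have [/set_mem xp|xp] := boolP (x \in prefix k a); last first.
    by rewrite indicE (negPf xp) !mul0r.
  case xj: (x j); first by rewrite subrr mulr0.
  by case/negP: xb; apply/mem_set; split => //; rewrite xp.
rewrite /g !indicE (mem_set xb) mul1r (swap_prefix lk kj al xb) -(vx xb).
by have [_ ->] := xb; rewrite subr0 mulr1.
Qed.

(* Sum [integral_flip_bit] over the block: both sides are then weighted by
   [count_ones], up to a deviation from its mean [M p]. *)
Lemma flip_bit_estimate delta v k (a : nat -> bool) l s
    (M : nat) (js : 'I_M -> nat) (p : R) :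
  swap_covariant delta v -> (l < k)%N -> a l ->
  injective js -> (forall m, k <= js m)%N ->
  (forall m, pr (js m) true = p) -> (forall m, pr (js m) false = 1 - p) ->
  (0 < M)%N -> 0 < p -> p < 1 ->
  `|\int[nu]_x (\1_(prefix k a) x * v s x) -
    odds l * \int[nu]_x (\1_(prefix k (clear_bit l a)) x *
      v (s + ln (odds l / (p / (1 - p)))) x)| <=
  delta * ((M%:R * (1 - p))^-1 + odds l * (M%:R * p)^-1) *
  \int[nu]_x `|count_ones js x - M%:R * p|.
Proof.
move=> cv lk al js_inj kjs jst jsf M0 p0 p1; have [_ vd _] := cv.
have p1' : 0 < 1 - p by rewrite subr_gt0.
have MR : 0 < M%:R :> R by rewrite ltr0n.
have oddsj m : odds (js m) = p / (1 - p) by rewrite /odds jst jsf.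
pose s' := s + ln (odds l / (p / (1 - p))).
set f1 := fun x => \1_(prefix k a) x * v s x.
set f0 := fun x => \1_(prefix k (clear_bit l a)) x * v s' x.
have bf1 : bounded_measurable f1 by exact: bounded_measurable_prefix cv.
have bf0 : bounded_measurable f0 by exact: bounded_measurable_prefix cv.
have bB : bounded_measurable (count_ones js : bitseqs -> R) by exact: bounded_measurable_count_ones.
have bc := fun c => @bounded_measurable_cst _ bitseqs R c.
have bi := fun f b => @bounded_measurable_integrable _ _ _ nu f b.
pose g1 x := f1 x * (M%:R - count_ones js x).
pose g0 x := f0 x * count_ones js x.
have bg1 : bounded_measurable g1.
  by apply: bounded_measurableM => //; exact: bounded_measurableB.
have bg0 : bounded_measurable g0 by exact: bounded_measurableM.
(* All coordinates of the block have the same odds, hence the same translation; summing over them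
   turns the bits into counts. *)
have exch : \int[nu]_x g1 x = odds l / (p / (1 - p)) * \int[nu]_x g0 x.
  transitivity (\int[nu]_x (\sum_m f1 x * (1 - (x (js m))%:R))).
    apply: eq_Rintegral => x _; rewrite -mulr_sumr sumrB; congr (_ * (_ - _)).
    by rewrite sumr_const card_ord.
  rewrite RintegralT_sum => [|m]; last first.
    apply: bounded_measurableM => //; apply: bounded_measurableB => //.
    exact: bounded_measurable_bit.
  transitivity (\int[nu]_x (\sum_m odds l / (p / (1 - p)) * (f0 x * (x (js m))%:R))).
    rewrite RintegralT_sum => [|m]; last first.
      apply: bounded_measurableM => //; apply: bounded_measurableM => //.
      exact: bounded_measurable_bit.
    apply: eq_bigr => m _; rewrite (integral_flip_bit _ cv lk (kjs m) al).
    rewrite oddsj RintegralZl//; apply: bi; apply: bounded_measurableM => //.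
    exact: bounded_measurable_bit.
  rewrite -RintegralZl//; last exact: bi.
  by apply: eq_Rintegral => x _; rewrite -mulr_sumr -mulr_sumr.
(* Reciprocals of the mean numbers of zeros and of ones, the latter times [odds l]. By [exch],
   [c1 * g1] and [c0 * g0] have equal integrals; adding their difference costs nothing and leaves an
   integrand proportional to the deviation [count_ones - M p]. *)
pose c1 := (M%:R * (1 - p))^-1; pose c0 := odds l * (M%:R * p)^-1.
have -> : \int[nu]_x f1 x - odds l * \int[nu]_x f0 x =
    \int[nu]_x ((f1 x - odds l * f0 x) + (c0 * g0 x - c1 * g1 x)).
  have b1 (c : R) (f : bitseqs -> R) : bounded_measurable f -> bounded_measurable (fun x => c * f x).
    by move=> bf; exact: bounded_measurableM (bc c) bf.
  rewrite RintegralD//; [|by apply/bi/bounded_measurableB => //; exact: b1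
                         |by apply/bi/bounded_measurableB => //; exact: b1].
  rewrite RintegralB//; [|exact: bi|exact/bi/b1].
  rewrite RintegralB//; [|exact/bi/b1|exact/bi/b1].
  rewrite !RintegralZl//; [|exact: bi|exact: bi|exact: bi].
  rewrite exch; set I0 := (\int[nu]_x g0 x).
  suff : c0 * I0 - c1 * (odds l / (p / (1 - p)) * I0) = 0 by move=> ->; rewrite addr0.
  by rewrite /c0 /c1; field; rewrite !gt_eqF.
have c1_ge0 : 0 <= c1 by rewrite ltW// invr_gt0 mulr_gt0.
have c0_ge0 : 0 <= c0.
  by rewrite ltW// mulr_gt0 ?odds_gt0// invr_gt0 mulr_gt0.
have bY : bounded_measurable (fun x => `|count_ones js x - M%:R * p|).
  by apply: bounded_measurable_norm; exact: bounded_measurableB.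
rewrite -RintegralZl//; last exact: bi.
apply: norm_RintegralT_le.
- apply: bounded_measurableD; apply: bounded_measurableB => //;
    exact: bounded_measurableM.
- exact: bounded_measurableM.
move=> x; set y := count_ones js x - M%:R * p.
have -> : f1 x - odds l * f0 x + (c0 * g0 x - c1 * g1 x) = (c1 * f1 x + c0 * f0 x) * y.
  by rewrite /g0 /g1 /c0 /c1 /y; field; rewrite !gt_eqF.
have f01 u b : 0 <= \1_(prefix k b) x * v u x <= delta.
  have /andP[v0 vle] := vd u x; rewrite mulr_ge0//= indicE.
  by case: (_ \in _); rewrite ?mul1r// mul0r (le_trans v0).
have /andP[f1_ge0 f1_le] := f01 s a; have /andP[f0_ge0 f0_le] := f01 s' (clear_bit l a).
rewrite normrM ler_wpM2r// ger0_norm; last by rewrite addr_ge0// mulr_ge0.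
by rewrite mulrDr lerD// [leRHS]mulrC ler_wpM2l.
Qed.

End swap_covariant.

Section clearing.
Context {R : realType} (q : nat -> probability bool R).
Variable nu : probability bitseqs R.
Hypothesis nuP : is_product_measure q nu.
Local Notation pr := (pr q).
Local Notation odds := (odds q).
Hypothesis pr_gt0 : forall i b, 0 < pr i b.
Hypothesis odds_le1 : forall i, odds i <= 1.

(** All that is kept of the sequences L and lambda: beyond any [k] there are equidistributed
    coordinates with arbitrarily large mean number of ones. The bound [p <= 1/2] reflects lambda <=
    1 and makes zeros at least as frequent as ones. *)
Definition has_large_blocks := forall (K : R) (k : nat),
  exists (M : nat) (js : 'I_M -> nat) (p : R),
  [/\ injective js, forall m, (k <= js m)%N,
      forall m, pr (js m) true = p /\ pr (js m) false = 1 - p,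
      0 < p <= 2^-1 & K <= M%:R * p].

Hypothesis large_blocks : has_large_blocks.

(** The block, and with it [s'], is chosen from [delta], [eps] and [k] alone, before [v] and [s]:
    the estimate is uniform over invariant sets. *)
Lemma flip_bit_approx (delta eps : R) k (a : nat -> bool) l :
  0 < delta -> 0 < eps -> (l < k)%N -> a l ->
  exists s', forall v s, swap_covariant q nu delta v ->
  `|\int[nu]_x (\1_(prefix k a) x * v s x) -
    odds l * \int[nu]_x (\1_(prefix k (clear_bit l a)) x * v (s + s') x)| <= eps.
Proof.
(* The final error is [eps / 2 + 2 delta^2 / (eps M p)], which is at most [eps] once
   [M p >= 4 delta^2 / eps^2]; the added 1 makes [K], hence [M p], positive. *)
move=> d0 e0 lk al; pose K := 4 * delta ^+ 2 / eps ^+ 2 + 1.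
have [M [js [p [js_inj kjs jsp /andP[p0 p2] KMp]]]] := large_blocks K k.
have p1 : p < 1 by rewrite (le_lt_trans p2)// invf_lt1// ltr1n.
have K0 : 0 < K.
  by rewrite ltr_wpDl// mulr_ge0// ?invr_ge0 ?sqr_ge0// mulr_ge0// sqr_ge0.
have Mp0 : 0 < M%:R * p by rewrite (lt_le_trans K0).
have M0 : (0 < M)%N by move: Mp0; rewrite pmulr_lgt0// ltr0n.
exists (ln (odds l / (p / (1 - p)))) => v s cv.
have e'0 : 0 < eps / (2 * delta) by rewrite divr_gt0// mulr_gt0.
set e' := eps / (2 * delta) in e'0.
apply: le_trans (flip_bit_estimate nuP pr_gt0 s cv lk al js_inj kjs
  (fun m => (jsp m).1) (fun m => (jsp m).2) M0 p0 p1) _.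
(* With [eta = e' M p], the first part of the deviation bound contributes exactly [eps / 2] and the
   second decays like [1 / (M p)]. *)
have := count_ones_deviation nuP js_inj (fun m => (jsp m).1) (mulr_gt0 e'0 Mp0).
set D := (\int[nu]_x _) => DE.
have D0 : 0 <= D by apply: Rintegral_ge0.
have {}DE : D <= M%:R * p * (e' + (e' * (M%:R * p))^-1) / 2.
  apply: (le_trans DE); rewrite ler_pM2r ?invr_gt0//.
  rewrite [leRHS]mulrDr; apply: lerD; first by rewrite mulrC.
  apply: ler_wpM2r; first by rewrite ltW// invr_gt0 mulr_gt0.
  by rewrite mulrA ger_pMr// gerBl ltW.
(* This uses [p <= 1/2] for the first term and [odds l <= 1] for the second. *)
have oc : (M%:R * (1 - p))^-1 + odds l * (M%:R * p)^-1 <= 2 * (M%:R * p)^-1.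
  rewrite mulr2n mulrDl !mul1r lerD//.
    rewrite lef_pV2 ?posrE ?mulr_gt0 ?subr_gt0 ?ltr0n// ler_pM2l ?ltr0n//.
    by move: p2; lra.
  by rewrite -[leRHS]mul1r ler_wpM2r// invr_ge0 ltW.
apply: (@le_trans _ _ (delta * (2 * (M%:R * p)^-1) * D)).
  by rewrite ler_wpM2r// ler_wpM2l// ltW.
apply: (@le_trans _ _ (delta * (2 * (M%:R * p)^-1) *
    (M%:R * p * (e' + (e' * (M%:R * p))^-1) / 2))).
  by rewrite ler_wpM2l// !mulr_ge0 ?invr_ge0 ?ltW.
have -> : delta * (2 * (M%:R * p)^-1) *
    (M%:R * p * (e' + (e' * (M%:R * p))^-1) / 2) =
    eps / 2 + 2 * delta ^+ 2 / eps * (M%:R * p)^-1.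
  move: Mp0; set y := M%:R * p => Mp0; rewrite /e'; field.
  by rewrite !gt_eqF.
have : 2 * delta ^+ 2 / eps * (M%:R * p)^-1 <= eps / 2.
  rewrite ler_pdivrMr//; apply: le_trans (ler_wpM2l _ KMp); last by rewrite ltW ?divr_gt0.
  rewrite /K mulrDr mulr1.
  have -> : eps / 2 * (4 * delta ^+ 2 / eps ^+ 2) = 2 * delta ^+ 2 / eps.
    by field; rewrite gt_eqF.
  by rewrite lerDl ltW ?divr_gt0.
by lra.
Qed.

(** Erase the ones from the last to the first. The coefficient is the product of the odds at the
    erased places, and [s'] the sum of the translations; neither depends on [v] or [s]. *)
Lemma clear_prefix_approx (delta : R) k (a : nat -> bool) : 0 < delta ->
  forall eps, 0 < eps ->
  exists c s', 0 <= c /\ forall v s, swap_covariant q nu delta v ->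
  `|\int[nu]_x (\1_(prefix k a) x * v s x) -
    c * \int[nu]_x (\1_(prefix k (fun=> false)) x * v (s + s') x)| <= eps.
Proof.
move=> d0.
(* Induction on a bound [n] for the support of the word. Beyond [k] the word is irrelevant to
   [prefix k] and can be set to 0. *)
suff H n : (n <= k)%N -> forall (b : nat -> bool), (forall i, (n <= i)%N -> b i = false) ->
    forall eps, 0 < eps -> exists c s', 0 <= c /\
    forall v s, swap_covariant q nu delta v ->
    `|\int[nu]_x (\1_(prefix k b) x * v s x) -
    c * \int[nu]_x (\1_(prefix k (fun=> false)) x * v (s + s') x)| <= eps.
  pose b i := if (i < k)%N then a i else false.
  have -> : prefix k a = prefix k b.
    by apply/seteqP; split => x xa i ik; have := xa i ik; rewrite /b ik.
  by apply: (H k (leqnn k) b) => i ki; rewrite /b ltnNge ki.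
elim: n => [_ b b0 eps e0|n ih nk b b0 eps e0].
  exists 1, 0; split => // v s cv.
  have -> : b = (fun=> false) by apply/funext => i; exact: b0.
  by rewrite addr0 mul1r subrr normr0 ltW.
have [bn|bn] := boolP (b n); last first.
  apply: (ih (ltnW nk)) => // i; rewrite leq_eqVlt => /predU1P[<-|]; last exact: b0.
  exact: negbTE.
have e2 : 0 < eps / 2 by rewrite divr_gt0.
have [s1 H1] := flip_bit_approx d0 e2 nk bn.
have o0 := odds_gt0 pr_gt0 n.
(* The tolerance is divided by [odds n] because the first erasure multiplies the remaining error by
   [odds n]. *)
have [c [s2 [c0 H2]]] : exists c s', 0 <= c /\
    forall v s, swap_covariant q nu delta v ->
    `|\int[nu]_x (\1_(prefix k (clear_bit n b)) x * v s x) -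
    c * \int[nu]_x (\1_(prefix k (fun=> false)) x * v (s + s') x)| <= eps / 2 / odds n.
  apply: (ih (ltnW nk)); last by rewrite divr_gt0.
  move=> i; rewrite /clear_bit leq_eqVlt => /predU1P[<-|ni]; first by rewrite eqxx.
  by case: eqP => // _; exact: b0.
exists (odds n * c), (s1 + s2); split; first by rewrite mulr_ge0// ltW.
move=> v s cv; have := H1 v s cv; have := H2 v (s + s1) cv; rewrite -addrA.
set I2 := \int[nu]_x _; set I3 := \int[nu]_x _; set I1 := \int[nu]_x _ => h2 h1.
have {}h2 : `|odds n * I2 - odds n * c * I3| <= eps / 2.
  rewrite -mulrA -mulrBr normrM gtr0_norm//.
  by rewrite -(ler_pM2l o0) in h2; rewrite (le_trans h2)// mulrC divfK// gt_eqF.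
have -> : I1 - odds n * c * I3 = (I1 - odds n * I2) + (odds n * I2 - odds n * c * I3).
  by rewrite subrKA.
rewrite (le_trans (ler_normD _ _))// [leRHS](splitr eps) lerD//.
Qed.

End clearing.

(** * The cocycle of an exchange and invariant sets *)

Section null_sets_of_products.
Context d1 d2 (T1 : measurableType d1) (T2 : measurableType d2) (R : realType).
Variable m1 : {measure set T1 -> \bar R}.
Variable m2 : {sigma_finite_measure set T2 -> \bar R}.

Lemma product_measure_eq0P (A : set (T1 * T2)) : measurable A ->
  (m1 \x m2)%E A = 0%E <-> {ae m1, forall x, m2 (xsection A x) = 0%E}.
Proof.
move=> mA; rewrite /product_measure1.
have mf := measurable_fun_xsection m2 mA.
have := ae_eq_integral_abs m1 measurableT mf.
rewrite (_ : \int[m1]_x `|_| = \int[m1]_x (m2 \o xsection A) x)%E; last first.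
  by apply: eq_integral => x _; rewrite gee0_abs.
by move=> ->; split; apply: filterS => x /=; [exact|move=> + _].
Qed.

Lemma ae_product_section (P : T1 * T2 -> Prop) :
  {ae (m1 \x m2)%E, forall w, P w} ->
  {ae m1, forall x, {ae m2, forall y, P (x, y)}}.
Proof.
move=> [N [mN N0 PN]].
have := (product_measure_eq0P mN).1 N0; apply: filterS => x Nx.
exists (xsection N x); split => //; first exact: measurable_xsection.
by move=> y /= nP; rewrite /xsection/=; apply/mem_set/PN.
Qed.

End null_sets_of_products.

(** Nullity is decided section by section. Hence e^u du, Lebesgue measure and the normal law may
    replace each other wherever only null sets matter. *)
Lemma eq_product_measure_null d1 d2 (T1 : measurableType d1)
    (T2 : measurableType d2) (R : realType) (m1 : {measure set T1 -> \bar R})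
    (m2 m3 : {sigma_finite_measure set T2 -> \bar R}) (A : set (T1 * T2)) :
  (forall B, measurable B -> m2 B = 0%E <-> m3 B = 0%E) -> measurable A ->
  (m1 \x m2)%E A = 0%E <-> (m1 \x m3)%E A = 0%E.
Proof.
move=> m23 mA; rewrite !product_measure_eq0P//.
by split; apply: filterS => x /m23; apply; exact: measurable_xsection.
Qed.

Section exp_measure_null.
Context {R : realType}.
Local Notation leb := (@lebesgue_measure R).

Lemma positive_density_eq0P (g : measurableTypeR R -> R) (A : set (measurableTypeR R)) :
  measurable_fun setT g -> (forall t, 0 < g t) -> measurable A ->
  (\int[leb]_(t in A) (g t)%:E)%E = 0%E <-> leb A = 0%E.
Proof.
move=> mg g0 mA.
have mf : measurable_fun A (EFin \o g).
  by apply/measurable_EFinP; exact: measurable_funTS.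
have := ae_eq_integral_abs leb mA mf.
rewrite (_ : \int[leb]_(t in A) `|_| = \int[leb]_(t in A) (g t)%:E)%E; last first.
  by apply: eq_integral => t _; rewrite gee0_abs// lee_fin ltW.
move=> ->; split => [|A0].
  move=> [N [mN N0 AN]]; apply: (subset_measure0 mA mN _ N0) => t At.
  by apply: AN => /= /(_ At) [] /eqP; rewrite gt_eqF.
exists A; split => //; first by move=> t /=; apply: contra_notP => nA /nA.
Qed.

Lemma exp_measure_eq0P (A : set (measurableTypeR R)) : measurable A ->
  exp_measure A = 0%E <-> leb A = 0%E.
Proof.
move=> mA; rewrite /exp_measure.
exact: (@positive_density_eq0P expR A (@measurable_expR R) (@expR_gt0 R) mA).
Qed.

Lemma normal_pdf_gt0 (t : R) : 0 < normal_pdf 0 1 t.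
Proof.
by rewrite normal_pdfE ?oner_eq0// mulr_gt0 ?expR_gt0// normal_peak_gt0 ?oner_eq0.
Qed.

Lemma normal_prob_eq0P (A : set (measurableTypeR R)) : measurable A ->
  normal_prob 0 1 A = 0%E <-> leb A = 0%E.
Proof.
move=> mA; rewrite /normal_prob.
exact: (@positive_density_eq0P (normal_pdf 0 1) A (measurable_normal_pdf 0 1)
  normal_pdf_gt0 mA).
Qed.

Lemma lebesgue_measure_translation (a : R) (A : set (measurableTypeR R)) :
  measurable A -> leb ((fun t => t + a) @^-1` A) = leb A.
Proof.
have mt : measurable_fun setT (fun t : measurableTypeR R => t + a : measurableTypeR R).
  exact: measurable_funD.
move=> mA; apply/esym.
rewrite -[RHS]/(pushforward_measure leb mt A).
apply: lebesgue_measure_unique => //= _ [[b c]] _ <-.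
rewrite -[RHS]/(leb ((fun t => t + a) @^-1` `]b, c]%classic)).
have -> : (fun t : R => t + a) @^-1` `]b, c]%classic = `]b - a, c - a]%classic.
  by apply/seteqP; split => t /=; rewrite !in_itv/= ltrBlDr lerBrDr.
rewrite !lebesgue_measure_itv/= !lte_fin ltrD2r; case: ifP => // _.
by rewrite -!EFinB opprB addrA subrK.
Qed.

End exp_measure_null.

Section swap_cocycle.
Context {R : realType} (q : nat -> probability bool R).
Variable nu : probability bitseqs R.
Hypothesis nuP : is_product_measure q nu.
Local Notation pr := (pr q).
Local Notation odds := (odds q).
Hypothesis pr_gt0 : forall i b, 0 < pr i b.

(** Split along the four values of the bits at [l] and [j]; [nu_swap] with positive weights handles
    each piece. This gives the absolute continuity needed for a derivative to exist. *)
Lemma nu_swap_eq0 l j (A : set bitseqs) : l != j -> measurable A ->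
  nu A = 0%E -> nu (swap l j @^-1` A) = 0%E.
Proof.
move=> lj mA A0.
have mS : measurable (swap l j @^-1` A).
  by rewrite -[X in measurable X]setTI; exact: measurable_swap.
have S0 a b : nu (swap l j @^-1` A `&` bits l j b a) = 0%E.
  have := nu_swap nuP a b lj mA.
  have -> : nu (A `&` bits l j a b) = 0%E.
    apply: (subset_measure0 _ mA _ A0); last by move=> x [].
    by apply: measurableI => //; exact: measurable_bits.
  rewrite mule0 => /eqP; rewrite mule_eq0 eqe gt_eqF/=; last exact: mulr_gt0.
  by move/eqP.
have -> : swap l j @^-1` A =
    ((swap l j @^-1` A `&` bits l j true true) `|`
     (swap l j @^-1` A `&` bits l j true false)) `|`
    ((swap l j @^-1` A `&` bits l j false true) `|`
     (swap l j @^-1` A `&` bits l j false false)).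
  rewrite -!setIUr; apply/esym/setIidl => x _ /=; rewrite /bits/=.
  by case: (x l); case: (x j); tauto.
have mB a b : measurable (swap l j @^-1` A `&` bits l j a b).
  by apply: measurableI => //; exact: measurable_bits.
have U0 (B C : set bitseqs) : measurable B -> measurable C ->
    nu B = 0%E -> nu C = 0%E -> nu (B `|` C) = 0%E.
  by move=> mB' mC B0 C0; exact: null_set_setU.
by apply: (U0); [exact: measurableU|exact: measurableU|exact: U0|exact: U0].
Qed.

Lemma swap_image l j (A : set bitseqs) : swap l j @` A = swap l j @^-1` A.
Proof.
apply/seteqP; split => [_ [x Ax <-]/=|x /= Ax]; first by rewrite swapK.
by exists (swap l j x) => //; rewrite swapK.
Qed.

(** [rn_cocycle] is a chosen derivative, so its value is known only almost everywhere, by comparing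
    integrals over the measurable subsets of [bits l j true false]. *)
Lemma rn_cocycle_swap l j : l != j ->
  {ae nu, forall x, bits l j true false x ->
    rn_cocycle nu (natural_action (swap_perm l j)) x = odds j / odds l}.
Proof.
move=> lj; pose D := rn_cocycle nu (natural_action (swap_perm l j)).
have mS : measurable_fun setT (swap l j) by exact: measurable_swap.
have moo : (pushforward_measure nu mS setT < +oo)%E.
  by rewrite -[ltLHS]/(nu setT) (le_lt_trans (probability_le1 nu measurableT))// ltry.
have [mD D0 DE] : is_rn_derivative (fun A => nu (swap l j @^-1` A)) nu D.
  (* The restriction to [setT] only equips the image measure with its finite measure structure; the
     same device recurs below. *)
  have H := @rn_derivativeP _ _ _ (mfrestr measurableT moo) nu.
  have E : (fun A => nu (natural_action (swap_perm l j) @` A)) =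
      (mfrestr measurableT moo : set bitseqs -> \bar R).
    apply/funext => A; rewrite -[RHS]/(nu (swap l j @^-1` (A `&` setT))).
    by rewrite setIT -swap_image.
  have E' : (fun A => nu (swap l j @^-1` A)) =
      (mfrestr measurableT moo : set bitseqs -> \bar R).
    by rewrite -E; apply/funext => A; rewrite -swap_image.
  rewrite E' /D /rn_cocycle E; apply: H.
  apply/null_content_dominatesP => A mA A0.
  rewrite -[LHS]/(nu (swap l j @^-1` (A `&` setT))) setIT.
  exact: nu_swap_eq0.
have mb := measurable_bits l j true false.
have : ae_eq nu (bits l j true false) (EFin \o D) (EFin \o cst (odds j / odds l)).
  apply: integral_ae_eq => //.
  - apply: (integrableS measurableT) => //; apply/integrableP; split.
      exact/measurable_EFinP.
    under eq_integral do rewrite /= ger0_norm//.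
    by rewrite -DE// -[ltLHS]/(nu setT) (le_lt_trans (probability_le1 nu measurableT))// ltry.
  - by apply/measurable_EFinP; exact: measurable_cst.
  move=> E Eb mE; rewrite -[LHS]DE//.
  transitivity ((odds j / odds l)%:E * nu E)%E; last by rewrite -integral_cst.
  have mSE : measurable (swap l j @^-1` E).
    by rewrite -[X in measurable X]setTI; exact: measurable_swap.
  (* Applied to the exchanged set, since [E] lies on the side where the bit at [l] is 1; the
     exchange being an involution, [E] itself reappears. *)
  have := nu_swap nuP false true lj mSE.
  have -> : swap l j @^-1` (swap l j @^-1` E) = E.
    by apply/seteqP; split => x /=; rewrite swapK.
  rewrite (setIidl Eb) (setIidl _); last first.
    by rewrite -(swap_bits l j true false) => x /=; exact: Eb.
  move=> H; have -> : odds j / odds l =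
      (pr l true * pr j false)^-1 * (pr l false * pr j true).
    by rewrite /odds !invfM invrK; ring.
  rewrite EFinM -muleA H muleA -EFinM mulVf ?mul1e//.
  by rewrite gt_eqF// mulr_gt0.
apply: filterS => x H xb; have := H xb; by case.
Qed.

End swap_cocycle.

Section crossing_time.
Context {R : realType} (q : nat -> probability bool R).
Variable nu : probability bitseqs R.
Local Notation leb := (@lebesgue_measure R).
Local Notation W := (bitseqs * measurableTypeR R)%type.
Implicit Types (Q : set W) (delta s : R).

Definition slab delta Q s : set W :=
  [set w | 0 <= w.2 < delta /\ Q (w.1, w.2 + s)].

Lemma measurable_rho s : measurable_fun setT (rho s : W -> W).
Proof.
apply: measurable_fun_pair; first exact: measurable_fst.
by apply: measurable_funD => //; exact: measurable_snd.
Qed.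

Lemma measurable_slab delta Q s : measurable Q -> measurable (slab delta Q s).
Proof.
move=> mQ; have -> : slab delta Q s =
    (snd @^-1` `[0, delta[%classic) `&` (rho s @^-1` Q).
  by apply/seteqP; split => w; rewrite /slab /rho/= in_itv.
apply: measurableI.
  by rewrite -[X in measurable X]setTI; apply: measurable_snd => //; exact: measurable_itv.
by rewrite -[X in measurable X]setTI; exact: measurable_rho.
Qed.

Definition crossing_time delta Q s (x : bitseqs) : R :=
  fine (leb (xsection (slab delta Q s) x)).

Lemma xsection_slab delta Q s x :
  xsection (slab delta Q s) x = [set t | 0 <= t < delta /\ Q (x, t + s)].
Proof. by rewrite xsectionE. Qed.

Lemma lebesgue_slab_le delta Q s x : 0 <= delta -> measurable Q ->
  (leb (xsection (slab delta Q s) x) <= delta%:E)%E.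
Proof.
move=> d0 mQ; apply: (@le_trans _ _ (leb `[0, delta[%classic)).
  apply: le_measure; rewrite ?inE.
  - by apply: measurable_xsection; exact: measurable_slab.
  - exact: measurable_itv.
  - by rewrite xsection_slab => t [t0 _]; rewrite /= in_itv.
by rewrite lebesgue_measure_itv/= lte_fin; case: ifP => _; rewrite -?EFinB ?lee_fin ?subr0.
Qed.

Lemma crossing_timeE delta Q s x : 0 <= delta -> measurable Q ->
  (crossing_time delta Q s x)%:E = leb (xsection (slab delta Q s) x).
Proof.
move=> d0 mQ; rewrite fineK// ge0_fin_numE//.
by rewrite (le_lt_trans (lebesgue_slab_le _ _ d0 mQ))// ltry.
Qed.

Lemma crossing_time_itv delta Q s x : 0 <= delta -> measurable Q ->
  0 <= crossing_time delta Q s x <= delta.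
Proof.
move=> d0 mQ; rewrite -!lee_fin crossing_timeE// measure_ge0/=.
exact: lebesgue_slab_le.
Qed.

Lemma measurable_crossing_time delta Q s : measurable Q ->
  measurable_fun setT (crossing_time delta Q s).
Proof.
move=> mQ; apply: measurableT_comp => //.
by apply: measurable_fun_xsection; exact: measurable_slab.
Qed.

Lemma slab_prefix_measure delta Q s (C : set bitseqs) : 0 <= delta ->
  measurable Q -> measurable C ->
  (nu \x leb)%E (slab delta Q s `&` (fst @^-1` C)) =
  (\int[nu]_x (\1_C x * crossing_time delta Q s x))%:E.
Proof.
move=> d0 mQ mC; rewrite /Rintegral.
have E : (\int[nu]_x (\1_C x * crossing_time delta Q s x)%:E =
   (nu \x leb) (slab delta Q s `&` (fst @^-1` C)))%E.
  rewrite /product_measure1; apply: eq_integral => x _.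
  rewrite EFinM crossing_timeE//= [in RHS]xsectionI indicE.
  have [/set_mem xC|xC] := boolP (x \in C).
    have -> : xsection (fst @^-1` C : set W) x = setT.
      by rewrite xsectionE; apply/seteqP; split => // t _.
    by rewrite mul1e setIT.
  have -> : xsection (fst @^-1` C : set W) x = set0.
    rewrite xsectionE; apply/seteqP; split => // t Cx.
    by case/negP: xC; apply/mem_set.
  by rewrite mul0e setI0 measure0.
rewrite E fineK//.
rewrite ge0_fin_numE// -E.
apply: (@le_lt_trans _ _ (\int[nu]_x (cst delta%:E) x)%E).
  apply: ge0_le_integral => //.
  - by move=> x _; rewrite lee_fin mulr_ge0//; have /andP[] := crossing_time_itv s x d0 mQ.
  - apply/measurable_EFinP/measurable_funM; first exact: measurable_indic.
    exact: measurable_crossing_time.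
  - move=> x _; rewrite lee_fin indicE; have /andP[c0 cd] := crossing_time_itv s x d0 mQ.
    by case: (_ \in _); rewrite ?mul1r// mul0r.
rewrite integral_cst//.
by rewrite lte_mul_pinfty// ?lee_fin// (le_lt_trans (probability_le1 nu measurableT))// ltry.
Qed.

Definition gamma_invariant Q := forall g : finperm,
  {ae (nu \x exp_measure (R := R))%E, forall w,
    Q (gamma nu natural_action g w) <-> Q w}.

Hypothesis nuP : is_product_measure q nu.
Hypothesis pr_gt0 : forall i b, 0 < pr q i b.

Lemma eq_measure_setD0 d (T : measurableType d) (m : {measure set T -> \bar R})
    (A B N : set T) : measurable A -> measurable B -> measurable N ->
  m N = 0%E -> (forall x, ~ N x -> A x <-> B x) -> m A = m B.
Proof.
move=> mA mB mN N0 AB.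
have H : A `|` N = B `|` N.
  apply/seteqP; split => x; have [Nx|Nx] := pselect (N x); try by right.
  - by move=> [/(AB _ Nx)|]; [left|].
  - by move=> [/(AB _ Nx)|]; [left|].
by rewrite -(measureU0 mA mN N0) H measureU0.
Qed.

(** [gamma] sends [(x, t + s)] to [(swap l j x, t + s + ln (odds l / odds j))], so for almost every
    [x] the same times [t] are counted on both sides, up to a null set. *)
Lemma crossing_time_covariant delta Q : 0 <= delta -> measurable Q ->
  gamma_invariant Q -> swap_covariant q nu delta (crossing_time delta Q).
Proof.
move=> d0 mQ Qinv; split; first by move=> s; exact: measurable_crossing_time.
  by move=> s x; exact: crossing_time_itv.
move=> l j s lj.
have := ae_product_section (Qinv (swap_perm l j)).
have := rn_cocycle_swap nuP pr_gt0 lj.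
apply: filterS2 => x Dx [N [mN N0 QN]] xb.
rewrite /crossing_time; congr fine.
have o0 := odds_gt0 pr_gt0.
(* The exceptional set concerns the time [t + s]; translation invariance keeps it null in [t]. *)
apply: (@eq_measure_setD0 _ (measurableTypeR R) leb _ _
  ((fun t : R => t + s) @^-1` N)).
- by apply: measurable_xsection; exact: measurable_slab.
- by apply: measurable_xsection; exact: measurable_slab.
- by rewrite -[X in measurable X]setTI; apply: measurable_funD.
- by apply: (etrans (lebesgue_measure_translation s mN)); exact/exp_measure_eq0P.
move=> t /= Nt; rewrite !xsection_slab/=.
have : Q (gamma nu natural_action (swap_perm l j) (x, t + s)) <-> Q (x, t + s).
  by apply: contrapT => nQ; apply: Nt; exact: QN.
suff -> : gamma nu natural_action (swap_perm l j) (x, t + s) =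
    (swap l j x, t + (s + ln (odds q l / odds q j))) by tauto.
rewrite /gamma; congr pair; rewrite [X in ln X]Dx//.
by rewrite !ln_div ?posrE ?o0//=; ring.
Qed.

End crossing_time.

(** * Density of the dyadic cells *)

Section approximation_by_algebras.
Context d (T : measurableType d) (R : realType).
Variable m : {finite_measure set T -> \bar R}.
Variable F : nat -> set (set T).
Hypothesis F_measurable : forall N A, F N A -> measurable A.
Hypothesis F0 : forall N, F N set0.
Hypothesis FC : forall N A, F N A -> F N (~` A).
Hypothesis FU : forall N A B, F N A -> F N B -> F N (A `|` B).

Definition symdiff (A B : set T) := (A `\` B) `|` (B `\` A).

Lemma measurable_symdiff A B : measurable A -> measurable B ->
  measurable (symdiff A B).
Proof. by move=> mA mB; apply: measurableU; exact: measurableD. Qed.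

(** Closeness is asked at all large levels because [F] is not assumed increasing: two sets can then
    be approximated at a common level. *)
Definition approx_set : set (set T) := [set A | measurable A /\
  forall eps : R, 0 < eps -> exists N0, forall N, (N0 <= N)%N ->
  exists2 B, F N B & (m (symdiff A B) <= eps%:E)%E].

Lemma le_measureU (A B C : set T) (e1 e2 : R) :
  measurable A -> measurable B -> measurable C -> C `<=` A `|` B ->
  (m A <= e1%:E)%E -> (m B <= e2%:E)%E -> (m C <= (e1 + e2)%:E)%E.
Proof.
move=> mA mB mC CAB Ae Be; apply: (@le_trans _ _ (m (A `|` B))).
  by apply: le_measure; rewrite ?inE//; exact: measurableU.
apply: (le_trans (@measureU2 _ _ _ m A B mA mB)).
by rewrite EFinD; exact: leeD.
Qed.

Lemma approx_setC A : approx_set A -> approx_set (~` A).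
Proof.
move=> [mA H]; split; first exact: measurableC.
move=> eps /H [N0 {}H]; exists N0 => N /H [B FB AB].
exists (~` B); first exact: FC.
have -> // : symdiff (~` A) (~` B) = symdiff A B.
apply/seteqP; split => x; rewrite /symdiff/=;
  by case: (pselect (A x)); case: (pselect (B x)); tauto.
Qed.

Lemma approx_setU A A' : approx_set A -> approx_set A' -> approx_set (A `|` A').
Proof.
move=> [mA HA] [mA' HA']; split; first exact: measurableU.
move=> eps eps0; have e2 : 0 < eps / 2 by rewrite divr_gt0.
have [N1 {}HA] := HA _ e2; have [N2 {}HA'] := HA' _ e2.
exists (maxn N1 N2) => N; rewrite geq_max => /andP[/HA[B FB AB] /HA'[B' FB' AB']].
exists (B `|` B'); first exact: FU.
have mB := F_measurable FB; have mB' := F_measurable FB'.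
rewrite (splitr eps); apply: le_measureU AB AB'.
- exact: measurable_symdiff.
- exact: measurable_symdiff.
- by apply: measurable_symdiff; exact: measurableU.
- by rewrite /symdiff => x /=; tauto.
Qed.

Lemma approx_set_sigma_algebra : sigma_algebra setT approx_set.
Proof.
split.
- split => // eps eps0; exists 0%N => N _; exists set0; first exact: F0.
  by rewrite /symdiff setDv setU0 measure0 lee_fin ltW.
- by move=> A; rewrite setTD; exact: approx_setC.
move=> A aA; have mA i : measurable (A i) by have [] := aA i.
have mUA : measurable (\bigcup_k A k) by exact: bigcup_measurable.
split => // eps eps0; have e2 : 0 < eps / 2 by rewrite divr_gt0.
pose U n := \big[setU/set0]_(i < n.+1) A i.
have aU n : approx_set (U n).
  rewrite /U; elim/big_ind: _ => //; last exact: approx_setU.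
  split => // e e0; exists 0%N => N _; exists set0; first exact: F0.
  by rewrite /symdiff setDv setU0 measure0 lee_fin ltW.
have mU n : measurable (U n) by have [] := aU n.
have cvgU : m (U n) @[n --> \oo] --> m (\bigcup_k A k).
  have -> : \bigcup_k A k = \bigcup_k U k by rewrite bigcup_bigsetU_bigcup.
  apply: nondecreasing_cvg_mu => //.
    exact: bigcup_measurable.
  by move=> i j ij; apply/subsetPset; exact: subset_bigsetU.
(* Continuity from below of the finite measure [m] reduces the countable union to a finite one, at
   the cost of half the tolerance. *)
have [n Un] : exists n, (m (\bigcup_k A k `\` U n) <= (eps / 2)%:E)%E.
  have mfin B : measurable B -> m B \is a fin_num by exact: fin_num_measure.
  have := cvgU; rewrite -[X in _ --> X]fineK ?mfin//.
  move=> /fine_cvgP[_ /cvgrPdist_le /(_ _ e2)] [n _ /(_ n (leqnn n))] H.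
  have UA : U n `<=` \bigcup_k A k by exact: bigsetU_bigcup.
  exists n; have -> : (m (\bigcup_k A k `\` U n) =
      (fine (m (\bigcup_k A k)))%:E - (fine (m (U n)))%:E)%E.
    rewrite !fineK ?mfin// [LHS]measureD//; first by rewrite (setIidr UA).
    by rewrite (@le_lt_trans _ _ (m (\bigcup_k A k)))// ltey_eq mfin.
  by rewrite -EFinB lee_fin (le_trans (ler_norm _)).
have [_ /(_ _ e2) [N0 H]] := aU n.
exists N0 => N /H [B FB UB]; exists B => //.
have mB := F_measurable FB.
rewrite (splitr eps); apply: le_measureU Un UB.
- exact: measurableD.
- exact: measurable_symdiff.
- exact: measurable_symdiff.
rewrite /symdiff => x /= [[Ax Bx]|[Bx Ax]].
  by have [Ux|Ux] := pselect (U n x); [right; left|left].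
by right; right; split => // Ux; apply: Ax; apply: bigsetU_bigcup Ux.
Qed.

End approximation_by_algebras.

Section dyadic_cells.
Context {R : realType}.
Variable nu : probability bitseqs R.
Local Notation leb := (@lebesgue_measure R).
Local Notation W := (bitseqs * measurableTypeR R)%type.
Local Notation m0 := (nu \x leb)%E.

Definition dyadic_floor (N : nat) (t : R) : int := Num.floor (2 ^+ N * t).

Lemma dyadic_floorP N (t : R) (i : int) :
  (dyadic_floor N t == i) = (i%:~R / 2 ^+ N <= t < (i%:~R + 1) / 2 ^+ N).
Proof.
have p2 : 0 < 2 ^+ N :> R by rewrite exprn_gt0.
rewrite floor_eq ler_pdivrMr// ltr_pdivlMr// [t * _]mulrC.
by rewrite intrD1.
Qed.

(** Such a set is a union of cells of level [N]: words of length [N] times dyadic intervals of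
    length 2^-N. *)
Definition determined (N : nat) (B : set W) := forall w w' : W,
  (forall i, (i < N)%N -> w.1 i = w'.1 i) ->
  dyadic_floor N w.2 = dyadic_floor N w'.2 -> B w -> B w'.

Definition dyadic_algebra (N : nat) : set (set W) :=
  [set B | measurable B /\ determined N B].

Definition strip (K : nat) : set W := [set w | - K%:R <= w.2 < K%:R].

Lemma measurable_strip K : measurable (strip K).
Proof.
have -> : strip K = snd @^-1` `[- K%:R, K%:R[%classic.
  by apply/seteqP; split => w; rewrite /strip/= in_itv.
by rewrite -[X in measurable X]setTI; apply: measurable_snd => //; exact: measurable_itv.
Qed.

Lemma product_measure_snd (A : set (measurableTypeR R)) : measurable A ->
  m0 (snd @^-1` A) = leb A.
Proof.
move=> mA; rewrite (_ : snd @^-1` A = setT `*` A); last first.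
  by apply/seteqP; split => // w [].
rewrite product_measure1E// -[RHS]mul1e; congr (_ * _)%E.
exact: probability_setT.
Qed.

Lemma strip_lty K : (m0 (strip K) < +oo)%E.
Proof.
have -> : strip K = snd @^-1` `[- K%:R, K%:R[%classic.
  by apply/seteqP; split => w; rewrite /strip/= in_itv.
rewrite product_measure_snd; last exact: measurable_itv.
by rewrite lebesgue_measure_itv/=; case: ifP; rewrite -?EFinB ltry.
Qed.

Definition strip_measure K : {finite_measure set W -> \bar R} :=
  mfrestr (measurable_strip K) (strip_lty K).

Lemma strip_measureE K A : strip_measure K A = m0 (A `&` strip K).
Proof. by []. Qed.

Lemma strip_measure_le K A : measurable A -> (strip_measure K A <= m0 A)%E.
Proof.
move=> mA; rewrite strip_measureE; apply: le_measure; rewrite ?inE//.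
by apply: measurableI => //; exact: measurable_strip.
Qed.

Lemma measurable_dyadic_floor N (i : int) :
  measurable ([set t | dyadic_floor N t = i] : set (measurableTypeR R)).
Proof.
have -> : [set t | dyadic_floor N t = i] =
    `[i%:~R / 2 ^+ N, (i%:~R + 1) / 2 ^+ N[%classic.
  apply/seteqP; split => t /=; rewrite in_itv/=.
    by move=> /eqP; rewrite dyadic_floorP.
  by rewrite -dyadic_floorP => /eqP.
exact: measurable_itv.
Qed.

Lemma lebesgue_dyadic_floor N (i : int) :
  leb [set t | dyadic_floor N t = i] = ((2 ^+ N)^-1)%:E.
Proof.
have -> : [set t | dyadic_floor N t = i] =
    `[i%:~R / 2 ^+ N, (i%:~R + 1) / 2 ^+ N[%classic.
  apply/seteqP; split => t /=; rewrite in_itv/=.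
    by move=> /eqP; rewrite dyadic_floorP.
  by rewrite -dyadic_floorP => /eqP.
have p2 : 0 < 2 ^+ N :> R by rewrite exprn_gt0.
rewrite lebesgue_measure_itv/= lte_fin ltr_pM2r ?invr_gt0// ltrDl ltr01 -EFinB.
by rewrite mulrDl mul1r addrAC subrr add0r.
Qed.

(** Rounding both endpoints to the dyadic grid errs only inside the two cells that contain them. *)
Lemma ocitv_approx K (a b : R) :
  approx_set (strip_measure K) dyadic_algebra (snd @^-1` `]a, b]%classic).
Proof.
have msnd (C : set (measurableTypeR R)) : measurable C ->
    measurable (snd @^-1` C : set W).
  move=> mC; rewrite -[X in measurable X]setTI; exact: measurable_snd.
have mab : measurable (snd @^-1` `]a, b]%classic : set W).
  by apply: msnd; exact: measurable_itv.
(* Two cells have total measure 2 / 2^N, and 2 / eps < N + 1 <= 2^N beyond this threshold. *)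
split => // eps eps0; exists (Num.truncn (2 / eps)) => N N0N.
have p2 : 0 < 2 ^+ N :> R by rewrite exprn_gt0.
(* The cells kept are those after the cell of [a], up to and including the cell of [b]. *)
pose lo := dyadic_floor N a + 1; pose hi := dyadic_floor N b + 1.
pose B : set W := [set w | lo <= dyadic_floor N w.2 < hi].
have mB : measurable B.
  rewrite (_ : B = snd @^-1` `[lo%:~R / 2 ^+ N, hi%:~R / 2 ^+ N[%classic).
    by apply: msnd; exact: measurable_itv.
  apply/seteqP; split => w; rewrite /B/= in_itv/= floor_ge_int floor_lt_int.
    by rewrite ler_pdivrMr// ltr_pdivlMr// ![w.2 * _]mulrC.
  by rewrite ler_pdivrMr// ltr_pdivlMr// ![w.2 * _]mulrC.
exists B; first by split => // w w' _ ww' /=; rewrite /B/= ww'.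
apply: (le_trans (strip_measure_le K (measurable_symdiff mab mB))).
pose cell c : set W := snd @^-1` [set t | dyadic_floor N t = dyadic_floor N c].
have mcell c : measurable (cell c).
  by apply: msnd; exact: measurable_dyadic_floor.
have cellE c : m0 (cell c) = ((2 ^+ N)^-1)%:E.
  rewrite product_measure_snd; last exact: measurable_dyadic_floor.
  exact: lebesgue_dyadic_floor.
apply: (@le_trans _ _ (m0 (cell a `|` cell b))).
  apply: le_measure; rewrite ?inE; [exact: measurable_symdiff|exact: measurableU|].
  have mono (u v : R) : u <= v -> dyadic_floor N u <= dyadic_floor N v.
    by move=> uv; apply: le_floor; rewrite ler_pM2l.
  rewrite /symdiff /cell /B => -[x t] /=; rewrite in_itv/=.
  move=> [[/andP[/ltW/mono at_ /mono tb]]|[/andP[at_ tb]]] H.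
    left; apply/eqP; apply: contrapT => /negP ne; apply: H.
    by rewrite /lo /hi ltzD1 tb andbT addrC lez1D lt_neqAle eq_sym ne at_.
  right; apply/eqP; rewrite eq_le -ltzD1 tb/= mono// leNgt; apply/negP => tb'.
  by apply: H; rewrite (ltW tb') andbT ltNge; apply/negP => /mono;
    rewrite leNgt -lez1D addrC at_.
apply: (le_trans (@measureU2 _ _ _ m0 _ _ (mcell a) (mcell b))).
have cell_le c : (m0 (cell c) <= ((2 ^+ N)^-1)%:E)%E by rewrite cellE.
apply: (le_trans (leeD (cell_le a) (cell_le b))).
rewrite -EFinD lee_fin -mulr2n -[leLHS]mulr_natl ler_pdivrMr// mulrC -ler_pdivrMr//.
apply: le_trans (ltW (truncnS_gt _)) _.
by rewrite -natrX ler_nat (leq_trans _ (ltn_expl N (ltnSn 1)))// ltnS.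
Qed.

(** The approximable sets form a sigma-algebra. It contains the preimages of coordinate sets, which
    are determined exactly, and those of intervals by [ocitv_approx], hence all measurable
    rectangles. *)
Lemma dyadic_algebra_approx K (A : set W) : measurable A ->
  approx_set (strip_measure K) dyadic_algebra A.
Proof.
have F0 N : dyadic_algebra N set0 by split.
have FC N B : dyadic_algebra N B -> dyadic_algebra N (~` B).
  move=> [mB dB]; split; first exact: measurableC.
  move=> w w' ww1 ww2 nB /= Bw'; apply: nB; apply: dB Bw' => //.
  by move=> i iN; rewrite ww1.
have FU N B C : dyadic_algebra N B -> dyadic_algebra N C -> dyadic_algebra N (B `|` C).
  move=> [mB dB] [mC dC]; split; first exact: measurableU.
  by move=> w w' ww1 ww2 [/(dB _ _ ww1 ww2)|/(dC _ _ ww1 ww2)]; [left|right].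
have FM N B : dyadic_algebra N B -> measurable B by case.
have sA := approx_set_sigma_algebra (strip_measure K) FM F0 FC FU.
pose sAT := approx_set (strip_measure K) dyadic_algebra.
have H1 (B : set bitseqs) : measurable B -> sAT (fst @^-1` B).
  have : <<s coordinate_sets >> `<=` [set B | sAT (fst @^-1` B)].
    apply: smallest_sub.
      split => /=.
      - by rewrite preimage_set0; case: sA.
      - by move=> C /= sC; case: sA => _ /(_ _ sC) + _; rewrite !setTD preimage_setC.
      - by move=> C /= sC; case: sA => _ _ /(_ _ sC); rewrite preimage_bigcup.
    move=> _ [i [C ->]] /=; split.
      rewrite -[X in measurable X]setTI; apply: measurable_fst => //.
      exact: measurable_coord.
    move=> eps eps0; exists i.+1 => N iN; exists (fst @^-1` [set x | C (x i)]).
      split; last by move=> w w' ww1 _ /=; rewrite ww1.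
      rewrite -[X in measurable X]setTI; apply: measurable_fst => //.
      exact: measurable_coord.
    by rewrite /symdiff setDv setU0 measure0 lee_fin ltW.
  exact.
have H2 (B : set (measurableTypeR R)) : measurable B -> sAT (snd @^-1` B).
  have : <<s R.-ocitv.-measurable >> `<=` [set B : set (measurableTypeR R) | sAT (snd @^-1` B)].
    apply: smallest_sub.
      split => /=.
      - by rewrite preimage_set0; case: sA.
      - by move=> C /= sC; case: sA => _ /(_ _ sC) + _; rewrite !setTD preimage_setC.
      - by move=> C /= sC; case: sA => _ _ /(_ _ sC); rewrite preimage_bigcup.
    move=> _ [[a b] _ <-] /=; exact: ocitv_approx.
  exact.
rewrite measurable_prod_measurableType.
suff : <<s [set A `*` B | A in measurable & B in measurable] >> `<=` sAT by exact.
apply: smallest_sub => // _ [B mB [C mC <-]].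
rewrite (_ : B `*` C = ~` (~` (fst @^-1` B) `|` ~` (snd @^-1` C))).
  apply: approx_setC => //; apply: approx_setU => //.
  - by apply: approx_setC => //; exact: H1.
  - by apply: approx_setC => //; exact: H2.
by rewrite setCU !setCK; apply/seteqP; split.
Qed.

End dyadic_cells.

Section cell_measure.
Context {R : realType}.
Variable nu : probability bitseqs R.
Local Notation leb := (@lebesgue_measure R).
Local Notation W := (bitseqs * measurableTypeR R)%type.
Local Notation m0 := (nu \x leb)%E.

Lemma product_measure_rho s (A : set W) : measurable A ->
  m0 (rho s @^-1` A) = m0 A.
Proof.
move=> mA; rewrite /product_measure1; apply: eq_integral => x _ /=.
rewrite -[RHS](lebesgue_measure_translation s); last exact: measurable_xsection.
by congr (leb _); rewrite !xsectionE.
Qed.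

Definition cell (N : nat) (a : nat -> bool) (i : int) : set W :=
  (fst @^-1` prefix N a) `&` [set w | dyadic_floor N w.2 = i].

Lemma measurable_cell N a i : measurable (cell N a i).
Proof.
apply: measurableI.
  rewrite -[X in measurable X]setTI; apply: measurable_fst => //.
  exact: measurable_prefix.
rewrite -[X in measurable X]setTI.
have mf := @measurable_dyadic_floor R N i.
exact: (@measurable_snd _ _ bitseqs (measurableTypeR R) measurableT _ mf).
Qed.

(** Translation by [i / 2^N] carries [0, 2^-N[ onto the dyadic interval of index [i], so all cells
    of level [N] are measured with the same [delta]. *)
Lemma cell_measure N a i (Q : set W) : measurable Q ->
  m0 (Q `&` cell N a i) = (\int[nu]_x
    (\1_(prefix N a) x * crossing_time (2 ^+ N)^-1 Q (i%:~R / 2 ^+ N) x))%:E.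
Proof.
move=> mQ; have p2 : 0 < 2 ^+ N :> R by rewrite exprn_gt0.
rewrite -slab_prefix_measure//; last exact: measurable_prefix.
rewrite -(product_measure_rho (i%:~R / 2 ^+ N)); last first.
  by apply: measurableI => //; exact: measurable_cell.
congr (m0 _); apply/seteqP; split => -[x t] /=.
  move=> [Qx [/= xa /eqP]]; rewrite dyadic_floorP lerDr mulrDl addrC ltrD2l mul1r => tN.
  by split.
move=> [[/= tN Qx] xa]; split => //; split => //=.
by apply/eqP; rewrite dyadic_floorP lerDr mulrDl addrC ltrD2l mul1r.
Qed.

(** The interval [-K, K[ holds [2 * K * 2 ^ N] dyadic intervals of level [N], numbered from 0;
    [indexed_cell] subtracts the offset [K * 2 ^ N]. *)
Definition cell_index N K := (N.-tuple bool * 'I_(2 * K * 2 ^ N))%type.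

Definition indexed_cell N K (c : cell_index N K) : set W :=
  cell N (nth false c.1) ((c.2)%:Z - (K * 2 ^ N)%:Z).

Lemma strip_cells N K : strip K = \bigcup_(c in [set: cell_index N K]) indexed_cell c.
Proof.
have p2 : 0 < 2 ^+ N :> R by rewrite exprn_gt0.
have KE : (K * 2 ^ N)%:Z%:~R / 2 ^+ N = K%:R :> R.
  by rewrite -pmulrn natrM natrX mulfK// gt_eqF.
apply/seteqP; split => [[x t]|[x t] [[a i] _ [_ /= /eqP]]]; rewrite /strip/=.
  move=> /andP[Kt tK]; pose f := dyadic_floor N t.
  have f1 : - (K * 2 ^ N)%:Z <= f.
    by rewrite floor_ge_int mulrC -ler_pdivrMr// mulrNz mulNr KE.
  have f2 : f < (K * 2 ^ N)%:Z.
    by rewrite floor_lt_int mulrC -ltr_pdivlMr// KE.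
  pose g : int := f + (K * 2 ^ N)%:Z.
  have iK : (absz g < 2 * K * 2 ^ N)%N by rewrite /g; lia.
  exists (mktuple (fun k : 'I_N => x k), Ordinal iK) => //; split => /=.
    by move=> k kN; rewrite -(nth_mktuple (fun k : 'I_N => x k) false (Ordinal kN)).
  by rewrite -/f /g; lia.
rewrite dyadic_floorP => /andP[it ti]; apply/andP; split.
  apply: le_trans it; rewrite -KE -mulNr ler_pM2r ?invr_gt0// -mulrNz ler_int.
  by lia.
apply: (lt_le_trans ti); rewrite -KE ler_pM2r ?invr_gt0// -intrD1 ler_int.
by have := ltn_ord i; lia.
Qed.

Lemma trivIset_cells N K : trivIset setT (@indexed_cell N K).
Proof.
apply/trivIsetP => -[a i] [b j] _ _ ab.
apply/seteqP; split => // -[x t] [[/= xa ti] [/= xb tj]].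
case/negP: ab; apply/eqP; congr pair; last first.
  by apply/val_inj => /=; move: tj; rewrite ti; lia.
apply: eq_from_tnth => k; rewrite !(tnth_nth false).
by rewrite -(xa k)// -(xb k).
Qed.

Lemma determined_cell N (B : set W) a i w : determined N B ->
  B w -> cell N a i w -> cell N a i `<=` B.
Proof.
move=> dB Bw [wa wi] w' [wa' wi']; apply: dB Bw => [k kN|].
  by rewrite wa// wa'.
by rewrite wi wi'.
Qed.

(** A determined set contains every cell that it meets; the coefficients are therefore 0 or 1 and do
    not depend on [Q]. *)
Lemma determined_measure N K (B Q : set W) : measurable Q -> measurable B ->
  determined N B ->
  m0 (Q `&` B `&` strip K) =
  (\sum_(c <- enum {: cell_index N K})
     (`[< B `&` indexed_cell c !=set0 >])%:R *
     fine (m0 (Q `&` indexed_cell c)))%:E.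
Proof.
move=> mQ mB dB; rewrite (strip_cells N K) setI_bigcupr measure_fin_bigcup; last 3 first.
- exact: finite_finset.
- apply: trivIset_setIl; exact: trivIset_cells.
- move=> c _; apply: measurableI; last exact: measurable_cell.
  exact: measurableI.
have -> : [set: cell_index N K] = [set` enum {: cell_index N K}].
  by apply/seteqP; split => // c _ /=; rewrite mem_enum.
rewrite -fsbig_seq ?enum_uniq// -sumEFin; apply: eq_bigr => c _.
have [[w [Bw cw]]|B0] := asboolP.
  rewrite mul1r cell_measure//= -cell_measure//.
  by congr (m0 _); rewrite -setIA; congr (_ `&` _); apply/setIidr;
     exact: determined_cell Bw cw.
rewrite mul0r -setIA (_ : B `&` _ = set0) ?setI0 ?measure0//.
by apply/seteqP; split => // w Bw; apply: B0; exists w.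
Qed.

End cell_measure.

(** * Nonnegative combinations of translates of the zero slab *)

Section translation_combinations.
Context {R : realType} (q : nat -> probability bool R).
Variable nu : probability bitseqs R.
Hypothesis nuP : is_product_measure q nu.
Hypothesis pr_gt0 : forall i b, 0 < pr q i b.
Hypothesis odds_le1 : forall i, odds q i <= 1.
Hypothesis large_blocks : has_large_blocks q.
Local Notation leb := (@lebesgue_measure R).
Local Notation W := (bitseqs * measurableTypeR R)%type.
Local Notation m0 := (nu \x leb)%E.
Implicit Types (Psi : set W -> R).

Definition invariant_set (Q : set W) := measurable Q /\ gamma_invariant nu Q.

(* The measure of the part of [C_0 x [0, 2^-N[] that [rho s] moves into [Q]. *)
Definition zero_slab N Q s : R := \int[nu]_x
  (\1_(prefix N (fun=> false)) x * crossing_time (2 ^+ N)^-1 Q s x).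

(** In each pair of [l], the first entry is a translation and the second its coefficient. *)
Definition combination N (l : seq (R * R)) Q : R :=
  \sum_(p <- l) p.2 * zero_slab N Q p.1.

(** Testing on invariant sets only stands in for the L^1 distance on the quotient. *)
Definition close_to e Psi Psi' :=
  forall Q, invariant_set Q -> `|Psi Q - Psi' Q| <= e.

Definition near_combination N e Psi := exists l : seq (R * R),
  (forall p, p \in l -> 0 <= p.2) /\ close_to e Psi (combination N l).

Lemma close_to_trans e1 e2 P1 P2 P3 :
  close_to e1 P1 P2 -> close_to e2 P2 P3 -> close_to (e1 + e2) P1 P3.
Proof.
move=> H1 H2 Q iQ; rewrite -(subrKA (P2 Q)).
by rewrite (le_trans (ler_normD _ _))// lerD ?H1 ?H2.
Qed.

Lemma near_combination_close N e1 e2 P1 P2 : close_to e1 P1 P2 ->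
  near_combination N e2 P2 -> near_combination N (e1 + e2) P1.
Proof. by move=> H1 [l [l0 H2]]; exists l; split => //; exact: close_to_trans H2. Qed.

Lemma near_combinationD N e1 e2 P1 P2 :
  near_combination N e1 P1 -> near_combination N e2 P2 ->
  near_combination N (e1 + e2) (fun Q => P1 Q + P2 Q).
Proof.
move=> [l1 [l10 H1]] [l2 [l20 H2]]; exists (l1 ++ l2); split.
  by move=> p; rewrite mem_cat => /orP[/l10|/l20].
move=> Q iQ; rewrite /combination big_cat/= opprD addrACA.
by rewrite (le_trans (ler_normD _ _))// lerD ?H1 ?H2.
Qed.

Lemma near_combinationZ N e c Psi : 0 <= c ->
  near_combination N e Psi -> near_combination N (c * e) (fun Q => c * Psi Q).
Proof.
move=> c0 [l [l0 H]]; exists [seq (p.1, c * p.2) | p <- l]; split.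
  by move=> _ /mapP[p /l0 p0 ->]; rewrite mulr_ge0.
move=> Q iQ; rewrite /combination big_map/=.
under eq_bigr do rewrite -mulrA.
by rewrite -mulr_sumr -mulrBr normrM ger0_norm// ler_wpM2l// H.
Qed.

Lemma near_combination0 N e : 0 <= e -> near_combination N e (fun=> 0).
Proof.
move=> e0; exists [::]; split => // Q _.
by rewrite /combination big_nil subr0 normr0.
Qed.

(** A threshold instead of one good level: finitely many functionals can then be approximated with
    the same zero slab. *)
Definition approximable Psi := forall e, 0 < e -> exists N0, forall N,
  (N0 <= N)%N -> near_combination N e Psi.

Lemma approximableD P1 P2 : approximable P1 -> approximable P2 ->
  approximable (fun Q => P1 Q + P2 Q).
Proof.
move=> H1 H2 e e0; have e2 : 0 < e / 2 by rewrite divr_gt0.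
have [N1 {}H1] := H1 _ e2; have [N2 {}H2] := H2 _ e2.
exists (maxn N1 N2) => N; rewrite geq_max => /andP[/H1 h1 /H2 h2].
by rewrite (splitr e); exact: near_combinationD.
Qed.

Lemma approximable0 : approximable (fun=> 0).
Proof.
by move=> e e0; exists 0%N => N _; apply: near_combination0; exact: ltW.
Qed.

Lemma approximable_sum (I : Type) (s : seq I) (P : pred I) (F : I -> set W -> R) :
  (forall i, P i -> approximable (F i)) ->
  approximable (fun Q => \sum_(i <- s | P i) F i Q).
Proof.
move=> H; elim: s => [|i s ih].
  rewrite (_ : (fun _ => _) = fun=> 0); first exact: approximable0.
  by apply/funext => Q; rewrite big_nil.
have [Pi|Pi] := boolP (P i); last first.
  rewrite (_ : (fun _ => _) = fun Q => \sum_(i <- s | P i) F i Q)//.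
  by apply/funext => Q; rewrite big_cons (negPf Pi).
rewrite (_ : (fun _ => _) = fun Q => F i Q + \sum_(i <- s | P i) F i Q).
  by apply: approximableD => //; exact: H.
by apply/funext => Q; rewrite big_cons Pi.
Qed.

Lemma approximableZ c Psi : 0 <= c -> approximable Psi ->
  approximable (fun Q => c * Psi Q).
Proof.
(* Dividing by [c + 1] also covers [c = 0]. *)
move=> c0 H e e0; have c1 : 0 < c + 1 by rewrite ltr_wpDl.
have [N0 {}H] := H _ (divr_gt0 e0 c1).
exists N0 => N /H /(near_combinationZ c0) [l [l0 {}H]]; exists l; split => // Q iQ.
rewrite (le_trans (H Q iQ))// mulrA ler_pdivrMr// mulrC ler_wpM2l//; first exact: ltW.
by rewrite lerDl.
Qed.

Lemma approximable_close Psi :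
  (forall e, 0 < e -> exists2 Psi', approximable Psi' & close_to e Psi Psi') ->
  approximable Psi.
Proof.
move=> H e e0; have e2 : 0 < e / 2 by rewrite divr_gt0.
have [Psi' /(_ _ e2) [N0 aP] cP] := H _ e2.
exists N0 => N /aP aN; rewrite (splitr e).
exact: near_combination_close cP aN.
Qed.

(** Here the erasure of words meets invariant sets: crossing times are covariant, so a single
    translate of the zero slab suffices, at every level [N]. *)
Lemma near_combination_cell N a i e : 0 < e ->
  near_combination N e (fun Q => fine (m0 (Q `&` cell N a i))).
Proof.
move=> e0; have d0 : 0 < (2 ^+ N)^-1 :> R by rewrite invr_gt0 exprn_gt0.
have [c [s' [c0 H]]] := clear_prefix_approx nuP pr_gt0 odds_le1 large_blocks
  N a d0 e0.
exists [:: (i%:~R / 2 ^+ N + s', c)]; split.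
  by move=> p; rewrite inE => /eqP ->.
move=> Q [mQ gQ]; rewrite cell_measure// /combination big_seq1/=.
by apply: H; apply: crossing_time_covariant => //; exact: ltW.
Qed.

Lemma near_combination_determined N K (B : set W) e : 0 < e ->
  measurable B -> determined N B ->
  near_combination N e (fun Q => fine (m0 (Q `&` B `&` strip K))).
Proof.
move=> e0 mB dB.
suff : near_combination N e (fun Q => \sum_(c <- enum {: cell_index N K})
     (`[< B `&` indexed_cell c !=set0 >])%:R * fine (m0 (Q `&` indexed_cell c))).
  move=> [l [l0 H]]; exists l; split => // Q iQ; have [mQ _] := iQ.
  by rewrite (determined_measure nu K mQ mB dB); exact: H.
elim: (enum _) e e0 => [|c s ih] e e0.
  rewrite (_ : (fun _ => _) = fun=> 0); first exact/near_combination0/ltW.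
  by apply/funext => Q; rewrite big_nil.
have e2 : 0 < e / 2 by rewrite divr_gt0.
rewrite (_ : (fun _ => _) = fun Q => (`[< B `&` indexed_cell c !=set0 >])%:R *
   fine (m0 (Q `&` indexed_cell c)) + \sum_(c <- s)
     (`[< B `&` indexed_cell c !=set0 >])%:R * fine (m0 (Q `&` indexed_cell c))); last first.
  by apply/funext => Q; rewrite big_cons.
rewrite (splitr e); apply: near_combinationD; last exact: ih.
case: asboolP => _.
  rewrite (_ : (fun _ => _) = fun Q => fine (m0 (Q `&` indexed_cell c))).
    exact: near_combination_cell.
  by apply/funext => Q; rewrite mul1r.
rewrite (_ : (fun _ => _) = fun=> 0); first exact/near_combination0/ltW.
by apply/funext => Q; rewrite mul0r.
Qed.

(** Replacing [A] by a nearby union of cells changes the measure of its intersection with [Q] by at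
    most that of the symmetric difference, whatever [Q]. *)
Lemma approximable_set K (A : set W) : measurable A ->
  approximable (fun Q => fine (m0 (Q `&` A `&` strip K))).
Proof.
move=> mA e e0; have e2 : 0 < e / 2 by rewrite divr_gt0.
have [_ /(_ _ e2)[N0 H]] := dyadic_algebra_approx nu K mA.
exists N0 => N /H [B [mB dB] AB].
rewrite (splitr e); apply: near_combination_close (near_combination_determined K e2 mB dB).
move=> Q [mQ _].
pose M := strip_measure nu K.
have fM C : measurable C -> M C = (fine (m0 (C `&` strip K)))%:E.
  by move=> mC; rewrite -[RHS]/((fine (M C))%:E) fineK//; exact: fin_num_measure.
have mQA : measurable (Q `&` A) by exact: measurableI.
have mQB : measurable (Q `&` B) by exact: measurableI.
have mS : measurable (symdiff A B) by exact: measurable_symdiff.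
have le1 (C D : set W) : measurable C -> measurable D -> C `<=` D `|` symdiff A B ->
    fine (m0 (C `&` strip K)) <= fine (m0 (D `&` strip K)) + e / 2.
  move=> mC mD CD; rewrite -lee_fin EFinD -fM// -fM//.
  apply: (@le_trans _ _ (M (D `|` symdiff A B))).
    by apply: le_measure; rewrite ?inE//; exact: measurableU.
  apply: (le_trans (@measureU2 _ _ _ M _ _ mD mS)).
  exact: leeD.
have h1 : fine (m0 (Q `&` B `&` strip K)) <= fine (m0 (Q `&` A `&` strip K)) + e / 2.
  apply: le1 => // x [Qx Bx].
  by have [Ax|Ax] := pselect (A x); [left|right; right].
have h2 : fine (m0 (Q `&` A `&` strip K)) <= fine (m0 (Q `&` B `&` strip K)) + e / 2.
  apply: le1 => // x [Qx Ax].
  by have [Bx|Bx] := pselect (B x); [left|right; left].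
by rewrite ler_norml; apply/andP; split; lra.
Qed.

End translation_combinations.

(** * Integration against a Radon-Nikodym derivative *)

Section rn_change_of_variables.
Context d (T : measurableType d) (R : realType).
Import HBNNSimple.
Local Open Scope ereal_scope.

Lemma integral_nnsfun_fsum (mu : {measure set T -> \bar R}) (E : set T)
    (h : {nnsfun T >-> R}) : measurable E ->
  \int[mu]_(x in E) (h x)%:E =
  \sum_(r \in range h) r%:E * mu (h @^-1` [set r] `&` E).
Proof.
move=> mE; under eq_integral do rewrite fimfunE -fsumEFin//.
rewrite ge0_integral_fsum//; last 2 first.
- by move=> r; apply/measurable_EFinP; exact: measurable_funM.
- by move=> r x _; rewrite nnfun_muleindic_ge0.
by apply: eq_fsbigr => r _; rewrite integralZl_indic_nnsfun// integral_indic.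
Qed.

(** Simple functions, then monotone convergence. Both measures are arbitrary because [integral_beta]
    applies this to an image of [mu], which may be infinite. *)
Lemma is_rn_derivative_integral (nu mu : {measure set T -> \bar R})
    (D : T -> R) (E : set T) (f : T -> \bar R) :
  is_rn_derivative nu mu D -> measurable E -> measurable_fun E f ->
  (forall x, E x -> 0 <= f x) ->
  \int[nu]_(x in E) f x = \int[mu]_(x in E) (f x * (D x)%:E).
Proof.
move=> [mD D0 DE] mE mf f0; pose h := nnsfun_approx mE mf.
have hf x : E x -> (EFin \o h ^~ x) n @[n --> \oo] --> f x.
  by move=> Ex; exact: cvg_nnsfun_approx.
have mh n : measurable_fun E (EFin \o h n).
  by apply/measurable_EFinP; exact: measurable_funTS.
have mDE : measurable_fun E (EFin \o D).
  by apply/measurable_EFinP; exact: measurable_funTS.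
transitivity (limn (fun n => \int[nu]_(x in E) (h n x)%:E)).
  rewrite -monotone_convergence//.
  - by apply: eq_integral => x /[!inE] Ex; apply/esym/cvg_lim => //; exact: hf.
  - by move=> n x _; rewrite lee_fin.
  - by move=> x _ a b ab; rewrite lee_fin; exact/lefP/nd_nnsfun_approx.
transitivity (limn (fun n => \int[mu]_(x in E) ((h n x)%:E * (D x)%:E))); last first.
  rewrite -monotone_convergence//.
  - apply: eq_integral => x /[!inE] Ex; apply/cvg_lim => //.
    by apply: cvgeZr => //; exact: hf.
  - by move=> n; exact: (emeasurable_funM (mh n) mDE).
  - by move=> n x _; rewrite mule_ge0// lee_fin.
  - move=> x _ a b ab; rewrite lee_wpmul2r// ?lee_fin//.
    exact/lefP/nd_nnsfun_approx.
congr (limn _); apply/funext => n; rewrite integral_nnsfun_fsum//.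
have mI r : measurable_fun E (fun x => (r * \1_(h n @^-1` [set r]) x)%:E).
  by apply/measurable_EFinP; exact: measurable_funM.
transitivity (\int[mu]_(x in E) (\sum_(r \in range (h n))
    ((r * \1_(h n @^-1` [set r]) x)%:E * (D x)%:E))); last first.
  apply: eq_integral => x _.
  rewrite -ge0_mule_fsuml => [|r]; last exact: nnfun_muleindic_ge0.
  by rewrite fsumEFin// -fimfunE.
rewrite ge0_integral_fsum//; last 2 first.
- by move=> r; exact: (emeasurable_funM (mI r) mDE).
- by move=> r x _; rewrite mule_ge0 ?nnfun_muleindic_ge0 ?lee_fin.
apply: eq_fsbigr => r /set_mem[y _ <-].
have mhE : measurable (h n @^-1` [set h n y] `&` E) by exact: measurableI.
rewrite DE// -ge0_integralZl//=; last 3 first.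
- by apply/measurable_EFinP; exact: measurable_funTS.
- by move=> x _; rewrite lee_fin.
- by rewrite lee_fin.
rewrite integral_mkcondl; apply: eq_integral => x _.
by rewrite patchE indicE; case: ifP => _; rewrite ?mulr1// mulr0 mul0e.
Qed.

End rn_change_of_variables.

Section approximable_integrable.
Context {R : realType} (q : nat -> probability bool R).
Variable nu : probability bitseqs R.
Hypothesis nuP : is_product_measure q nu.
Hypothesis pr_gt0 : forall i b, 0 < pr q i b.
Hypothesis odds_le1 : forall i, odds q i <= 1.
Hypothesis large_blocks : has_large_blocks q.
Local Notation leb := (@lebesgue_measure R).
Local Notation W := (bitseqs * measurableTypeR R)%type.
Local Notation m0 := (nu \x leb)%E.
Import HBNNSimple.

Lemma approximable_nnsfun K (h : {nnsfun W >-> R}) :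
  approximable nu (fun Q => fine (\int[m0]_(w in Q `&` strip K) (h w)%:E)%E).
Proof.
(* [approximableZ] wants nonnegative coefficients for every [r]; on the range of [h] the absolute
   value changes nothing. *)
have H : approximable nu (fun Q => \sum_(r <- finmap.enum_fset (fset_set (range h)))
    `|r| * fine (m0 (Q `&` (h @^-1` [set r]) `&` strip K))).
  apply: approximable_sum => r _; apply: approximableZ => //.
  exact: approximable_set.
move=> e /H [N0 {}H]; exists N0 => N /H [l [l0 {}H]]; exists l; split => // Q iQ.
have [mQ _] := iQ; apply: le_trans (H Q iQ).
rewrite integral_nnsfun_fsum; last by apply: measurableI => //; exact: measurable_strip.
rewrite fsbig_finite//=.
rewrite (eq_big_seq (fun r => (`|r| * fine (m0 (Q `&` (h @^-1` [set r]) `&` strip K)))%:E)).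
  by rewrite sumEFin.
move=> r; rewrite in_fset_set// => /set_mem[w _ <-].
rewrite ger0_norm// EFinM; congr (_ * _)%E.
rewrite (_ : h @^-1` [set h w] `&` (Q `&` strip K) =
    Q `&` (h @^-1` [set h w]) `&` strip K); last first.
  by rewrite setICA setIA.
rewrite -[RHS]/((fine (strip_measure nu K (Q `&` (h @^-1` [set h w]))))%:E).
rewrite fineK//; apply: fin_num_measure; exact: measurableI.
Qed.

(** Truncated simple functions increase to [phi]. The error over [Q] is at most the error over the
    whole space, which gives uniformity in [Q]. *)
Lemma approximable_integrable (phi : W -> R) : measurable_fun setT phi ->
  (forall w, 0 <= phi w) -> (\int[m0]_w (phi w)%:E < +oo)%E ->
  approximable nu (fun Q => fine (\int[m0]_(w in Q) (phi w)%:E)%E).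
Proof.
move=> mphi phi0 phioo; apply: approximable_close => e e0.
have mE : measurable_fun setT (EFin \o phi) by exact/measurable_EFinP.
pose h := nnsfun_approx measurableT mE.
(* The strip grows with [n], since simple functions have been handled only inside a strip of finite
   measure. *)
pose G n w := h n w * \1_(strip n) w.
have Ephi0 w : setT w -> (0 <= (EFin \o phi) w)%E by move=> _; rewrite lee_fin.
have mG n : measurable_fun setT (G n).
  by apply: measurable_funM => //; apply: measurable_indic; exact: measurable_strip.
have G0 n w : 0 <= G n w by rewrite mulr_ge0.
have ndG w : nondecreasing_seq (G^~ w).
  move=> a b ab; rewrite /G ler_pM//; first exact/lefP/nd_nnsfun_approx.
  rewrite !indicE ler_nat; have [/set_mem wa|//] := boolP (w \in strip a).
  rewrite mem_set//; move: wa => /andP[aw wa]; apply/andP; split.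
    by apply: le_trans aw; rewrite lerN2 ler_nat.
  by apply: lt_le_trans wa _; rewrite ler_nat.
have cvgh w : (h n w) @[n --> \oo] --> phi w.
  by have /fine_cvgP[_] := cvg_nnsfun_approx measurableT mE Ephi0 (Logic.I : setT w).
have cvgG w : (G n w) @[n --> \oo] --> phi w.
  rewrite -[phi w]mulr1; apply: cvgM; first exact: cvgh.
  apply: cvg_near_cst; exists (Num.truncn `|w.2|).+1 => // n /= wn.
  rewrite indicE mem_set// /strip/=.
  have : `|w.2| < n%:R by rewrite (lt_le_trans (truncnS_gt _))// ler_nat.
  by rewrite ltr_norml => /andP[/ltW -> ->].
have Gphi n w : G n w <= phi w.
  have := nondecreasing_cvgn_le (ndG w) (cvgP _ (cvgG w)) n.
  by rewrite (cvg_lim _ (cvgG w)).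
have cvgI : (\int[m0]_w (G n w)%:E)%E @[n --> \oo] --> (\int[m0]_w (phi w)%:E)%E.
  rewrite [X in _ --> X](_ : _ = (\int[m0]_w limn (fun n => (G n w)%:E))%E).
    apply: cvg_monotone_convergence => //.
    - by move=> n; exact/measurable_EFinP.
    - by move=> n w _; rewrite lee_fin.
    - by move=> w _ a b ab; rewrite lee_fin; exact: ndG.
  apply: eq_integral => w _; apply/esym/cvg_lim => //.
  by apply: cvg_EFin; [exact: nearW|exact: cvgG].
have phifin : (\int[m0]_w (phi w)%:E)%E \is a fin_num.
  by rewrite ge0_fin_numE//; apply: integral_ge0 => w _; rewrite lee_fin.
move: cvgI; rewrite -(fineK phifin) => /fine_cvgP[_ /cvgrPdist_le /(_ _ e0)].
move=> [n _ /(_ n (leqnn n)) /= H].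
pose D w := phi w - G n w.
have D0 w : 0 <= D w by rewrite subr_ge0.
have mD : measurable_fun setT D by exact: measurable_funB.
have split_int (Q : set W) : measurable Q ->
    (\int[m0]_(w in Q) (phi w)%:E =
     \int[m0]_(w in Q) (G n w)%:E + \int[m0]_(w in Q) (D w)%:E)%E.
  move=> mQ; rewrite -ge0_integralD//.
  - by apply: eq_integral => w _; rewrite -EFinD /D addrC subrK.
  - by move=> w _; rewrite lee_fin.
  - by apply/measurable_EFinP; exact: measurable_funTS.
  - by move=> w _; rewrite lee_fin.
  - by apply/measurable_EFinP; exact: measurable_funTS.
have int0 (Q : set W) (f : W -> R) : (forall w, 0 <= f w) ->
    (0 <= \int[m0]_(w in Q) (f w)%:E)%E.
  by move=> f0; apply: integral_ge0 => w _; rewrite lee_fin.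
have intfin (Q : set W) (f : W -> R) : measurable Q -> measurable_fun setT f ->
    (forall w, 0 <= f w <= phi w) -> (\int[m0]_(w in Q) (f w)%:E)%E \is a fin_num.
  move=> mQ mf f0; have f00 w : 0 <= f w by have /andP[] := f0 w.
  rewrite ge0_fin_numE ?int0//; apply: le_lt_trans phioo.
  apply: (@le_trans _ _ (\int[m0]_w (f w)%:E)%E).
    apply: ge0_subset_integral => //; first exact/measurable_EFinP.
    by move=> w _; rewrite lee_fin.
  apply: ge0_le_integral => //.
  - by move=> w _; rewrite lee_fin.
  - exact/measurable_EFinP.
  - by move=> w _; rewrite lee_fin; have /andP[] := f0 w.
have Gb w : 0 <= G n w <= phi w by rewrite G0 Gphi.
have Db w : 0 <= D w <= phi w by rewrite D0 /D gerBl G0.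
exists (fun Q => fine (\int[m0]_(w in Q `&` strip n) (h n w)%:E)%E).
  exact: approximable_nnsfun.
move=> Q [mQ _].
have -> : (\int[m0]_(w in Q `&` strip n) (h n w)%:E = \int[m0]_(w in Q) (G n w)%:E)%E.
  rewrite integral_mkcondr; apply: eq_integral => w _.
  by rewrite patchE /G indicE; case: ifP => _; rewrite ?mulr1 ?mulr0.
rewrite split_int// fineD ?intfin// addrAC subrr add0r ger0_norm; last exact/fine_ge0/int0.
move: H; rewrite split_int// fineD ?intfin// addrAC subrr add0r.
rewrite ger0_norm; last exact/fine_ge0/int0.
apply: le_trans; apply: fine_le; rewrite ?intfin//.
apply: ge0_subset_integral => //; first exact/measurable_EFinP.
by move=> w _; rewrite lee_fin.
Qed.

End approximable_integrable.

(** * The flow on the quotient *)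

Section quasi_invariant_flow.
Context (R : realType) d (Z : measurableType d).
Variable mu : {sigma_finite_measure set Z -> \bar R}.

Lemma indic_Lfun_infty d' (T : measurableType d') (m : {measure set T -> \bar R})
  (A : set T) : measurable A -> (\1_A : T -> R) \in Lfun m +oo%E.
Proof.
move=> mA; rewrite inE; apply/andP; split; rewrite inE/=.
  exact: measurable_indic.
rewrite /finite_norm unlock; case: ifPn => // _.
apply: (@le_lt_trans _ _ 1%:E); last exact: ltry.
apply/ess_sup_inf.ess_supP; apply: aeW => x /=; rewrite lee_fin indicE.
by case: (_ \in _); rewrite ?normr1// normr0.
Qed.

Lemma ge0_integrable d' (T : measurableType d') (m : {measure set T -> \bar R})
    (f : T -> R) : measurable_fun setT f -> (forall x, 0 <= f x) ->
  (\int[m]_x (f x)%:E < +oo)%E -> m.-integrable setT (EFin \o f).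
Proof.
move=> mf f0 foo; apply/integrableP; split; first exact/measurable_EFinP.
by under eq_integral do rewrite /= ger0_norm//.
Qed.

(** Use the hypothesis on the set where [g <= f] and on its complement: each contributes [e] to the
    norm. *)
Lemma Lnorm1_le_setwise (f g : Z -> R) (e : R) :
  mu.-integrable setT (EFin \o f) -> mu.-integrable setT (EFin \o g) ->
  (forall P, measurable P ->
    `|\int[mu]_(z in P) f z - \int[mu]_(z in P) g z| <= e) ->
  ('N[mu]_1[(fun z => (f z - g z)%:E)] <= (e + e)%:E)%E.
Proof.
move=> intf intg H; rewrite Lnorm1.
have mf : measurable_fun setT f by apply/measurable_EFinP; exact: measurable_int intf.
have mg : measurable_fun setT g by apply/measurable_EFinP; exact: measurable_int intg.
pose P := [set z | g z <= f z].
have mP : measurable P.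
  by rewrite -[P]setTI; exact: measurable_fun_le.
have mPC : measurable (~` P) by exact: measurableC.
have intS (h : Z -> R) A : measurable A -> mu.-integrable setT (EFin \o h) ->
    mu.-integrable A (EFin \o h).
  by move=> mA ih; exact: integrableS ih.
have intB (h1 h2 : Z -> R) A : measurable A -> mu.-integrable setT (EFin \o h1) ->
    mu.-integrable setT (EFin \o h2) ->
    (\int[mu]_(z in A) (h1 z - h2 z)%:E)%E =
    (\int[mu]_(z in A) h1 z - \int[mu]_(z in A) h2 z)%:E.
  move=> mA i1 i2; rewrite -RintegralB//; [|exact: intS|exact: intS].
  rewrite /Rintegral fineK//; apply: integrable_fin_num => //.
  exact: (integrableB mA (intS _ _ mA i1) (intS _ _ mA i2)).
rewrite -(setUv P) ge0_integral_setU//; last 2 first.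
- rewrite setUv; apply: measurableT_comp => //.
  by apply/measurable_EFinP; exact: measurable_funB.
- by apply/disj_setPS => z [].
rewrite EFinD leeD//.
  rewrite (eq_integral (fun z => (f z - g z)%:E)); last first.
    by move=> z /set_mem Pz; rewrite /= ger0_norm// subr_ge0.
  by rewrite intB// lee_fin (le_trans (ler_norm _))// H.
rewrite (eq_integral (fun z => (g z - f z)%:E)); last first.
  move=> z /set_mem Pz; rewrite /= distrC ger0_norm// subr_ge0 ltW// ltNge.
  exact/negP.
by rewrite intB// lee_fin (le_trans (ler_norm _))// distrC H.
Qed.

Lemma measurable_invr_ge0 d' (T : measurableType d') (f : T -> R) :
  measurable_fun setT f -> (forall x, 0 <= f x) ->
  measurable_fun setT (fun x => (f x)^-1).
Proof.
move=> mf f0; rewrite (_ : (fun _ => _) = fun x => f x `^ (-1)).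
  exact: (measurableT_comp (@measurable_powR R (-1)) mf).
by apply/funext => x; rewrite powR_inv1.
Qed.

Variable kappa : {finite_measure set Z -> \bar R}.
Hypothesis kappa_null : forall A, measurable A -> kappa A = 0%E <-> mu A = 0%E.
Local Notation k := (rn_derivative kappa mu).

(** [kappa] is a finite measure equivalent to [mu]; its density [k], positive almost everywhere,
    reduces derivatives of sigma-finite measures to those of finite ones. *)
Lemma kappa_derivative : is_rn_derivative kappa mu k.
Proof.
by apply: rn_derivativeP; apply/null_content_dominatesP => A mA /kappa_null; exact.
Qed.

Lemma kappa_derivative_gt0 : {ae mu, forall z, 0 < k z}.
Proof.
have [mk k0 kE] := kappa_derivative.
pose A := [set z | k z <= 0].
have mA : measurable A by rewrite -[A]setTI; exact: measurable_fun_le.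
exists A; split => //; last by move=> z /= /negP; rewrite -leNgt.
apply/kappa_null => //; rewrite kE//.
apply: integral0_eq => z /= Az; congr EFin; apply/eqP; rewrite eq_le Az.
exact: k0.
Qed.

Lemma integral_kappa_inv (f : Z -> R) P : measurable P ->
  measurable_fun setT f -> (forall z, 0 <= f z) ->
  (\int[kappa]_(z in P) (f z / k z)%:E = \int[mu]_(z in P) (f z)%:E)%E.
Proof.
move=> mP mf f0; have [mk k0 kE] := kappa_derivative.
have mfk : measurable_fun setT (fun z => f z / k z).
  by apply: measurable_funM => //; exact: measurable_invr_ge0.
rewrite (is_rn_derivative_integral kappa_derivative)//; last 2 first.
- by apply/measurable_EFinP; exact: measurable_funTS.
- by move=> z _; rewrite lee_fin divr_ge0.
apply: ge0_ae_eq_integral => //.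
- apply: emeasurable_funM; apply/measurable_EFinP; exact: measurable_funTS.
- by apply/measurable_EFinP; exact: measurable_funTS.
- by move=> z _; rewrite mule_ge0// lee_fin// divr_ge0.
- by move=> z _; rewrite lee_fin.
apply: filterS kappa_derivative_gt0 => z kz _.
by rewrite -EFinM divfK// gt_eqF.
Qed.

Lemma aut_image (g : automorphism Z) A : g @` A = aut_inv g @^-1` A.
Proof.
apply/seteqP; split => [_ [z Az <-]/=|z /= Az]; first by rewrite aut_funK.
by exists (aut_inv g z) => //=; rewrite aut_invK.
Qed.

Lemma measurable_aut_image (g : automorphism Z) A : measurable A ->
  measurable (g @` A).
Proof.
move=> mA; rewrite aut_image -[X in measurable X]setTI.
exact: (measurable_aut_inv_fun g).
Qed.

(* [mu \o image g] is only sigma-finite, so its derivative is that of the finite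
   measure [kappa \o image g] divided by [k \o g]. *)
Lemma rn_cocycleP (g : automorphism Z) : nonsingular mu g ->
  is_rn_derivative (fun A => mu (g @` A)) mu (rn_cocycle mu g).
Proof.
move=> nsg; have [mk k0 kE] := kappa_derivative.
have mgi := measurable_aut_inv_fun g.
have moo : (pushforward_measure kappa mgi setT < +oo)%E.
  by rewrite -[ltLHS]/(kappa setT) ltey_eq fin_num_measure.
pose kg : {finite_measure set Z -> \bar R} := mfrestr measurableT moo.
have kgE A : kg A = kappa (g @` A).
  by rewrite -[LHS]/(kappa (aut_inv g @^-1` (A `&` setT))) setIT -aut_image.
have kgmu : kg `<< mu.
  apply/null_content_dominatesP => A mA A0; rewrite [LHS]kgE.
  apply/kappa_null; first exact: measurable_aut_image.
  exact/nsg.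
have Dk := rn_derivativeP kgmu; have [mD D0 DE] := Dk.
set D := rn_derivative kg mu in Dk mD D0 DE.
(* Exhibiting one derivative is enough: [xget] then returns an element of a nonempty set. *)
suff : is_rn_derivative (fun A => mu (g @` A)) mu (fun z => D z / k (g z)).
  by rewrite /rn_cocycle /rn_derivative => H; case: xgetP => [//|/(_ _ H)].
have mkg : measurable_fun setT (fun z => (k (g z))^-1).
  apply: measurable_invr_ge0 => //.
  by apply: measurableT_comp => //; exact: measurable_aut_fun.
split.
- exact: measurable_funM.
- by move=> z; rewrite divr_ge0.
move=> A mA.
(* Transport by [g]: this is the integral of [1 / k] against [kappa] over the image of [A], that is,
   the [mu]-measure of that image. *)
transitivity (\int[kg]_(z in A) ((k (g z))^-1)%:E)%E; last first.
  rewrite (is_rn_derivative_integral Dk)//.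
  - by apply: eq_integral => z _; rewrite -EFinM mulrC.
  - by apply/measurable_EFinP; exact: measurable_funTS.
  - by move=> z _; rewrite lee_fin invr_ge0.
transitivity (\int[pushforward_measure kappa mgi]_(z in A) ((k (g z))^-1)%:E)%E; last first.
  apply: eq_measure_integral => B mB _.
  by rewrite [RHS](kgE B) aut_image.
rewrite /pushforward_measure ge0_integral_pushforward//=; last 2 first.
- by apply/measurable_EFinP; exact: measurable_funTS.
- by move=> z _; rewrite lee_fin invr_ge0.
rewrite -[aut_inv_fun g @^-1` A]/(aut_inv g @^-1` A) -aut_image.
have mgA := measurable_aut_image g mA.
transitivity (\int[mu]_(z in g @` A) (1%R)%:E)%E.
  by rewrite integral_cst// mul1e.
rewrite -integral_kappa_inv//.
by apply: eq_integral => z _; rewrite div1r /= aut_invK.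
Qed.

Lemma nonsingular_aut_inv (g : automorphism Z) :
  nonsingular mu g -> nonsingular mu (aut_inv g).
Proof.
move=> nsg A mA; have := nsg (aut_inv g @` A) (measurable_aut_image (aut_inv g) mA).
rewrite (_ : g @` (aut_inv g @` A) = A); first by tauto.
by rewrite !aut_image; apply/seteqP; split => z /=; rewrite (aut_invK g).
Qed.

Lemma measurable_beta (g : automorphism Z) (f : Z -> R) : nonsingular mu g ->
  measurable_fun setT f -> measurable_fun setT (beta mu g f).
Proof.
move=> /nonsingular_aut_inv/rn_cocycleP[mD _ _] mf.
apply: measurable_funM => //.
by apply: measurableT_comp => //; exact: (measurable_aut_inv_fun g).
Qed.

Lemma beta_ge0 (g : automorphism Z) (f : Z -> R) : nonsingular mu g ->
  (forall z, 0 <= f z) -> forall z, 0 <= beta mu g f z.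
Proof.
by move=> /nonsingular_aut_inv/rn_cocycleP[_ D0 _] f0 z; rewrite mulr_ge0.
Qed.

(** [beta mu g f] is the density of the image under [g] of the measure with density [f]; in this
    dual form only preimages of [P] occur. *)
Lemma integral_beta (g : automorphism Z) (f : Z -> R) P : nonsingular mu g ->
  measurable P -> measurable_fun setT f -> (forall z, 0 <= f z) ->
  (\int[mu]_(z in P) (beta mu g f z)%:E =
   \int[mu]_(z in g @^-1` P) (f z)%:E)%E.
Proof.
move=> nsg mP mf f0.
have mg := measurable_aut_fun g.
have nsi := nonsingular_aut_inv nsg.
have := rn_cocycleP nsi.
have -> : (fun A => mu (aut_inv g @` A)) = pushforward_measure mu mg.
  by apply/funext => A; rewrite aut_image.
move=> H; have [mD D0 _] := H.
have mfg : measurable_fun setT (fun z => f (aut_inv g z)).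
  by apply: measurableT_comp => //; exact: (measurable_aut_inv_fun g).
transitivity (\int[pushforward_measure mu mg]_(z in P) (f (aut_inv g z))%:E)%E.
  rewrite (is_rn_derivative_integral H)//.
  - by apply/measurable_EFinP; exact: measurable_funTS.
  - by move=> z _; rewrite lee_fin.
rewrite /pushforward_measure ge0_integral_pushforward//=.
- by apply: eq_integral => z _; rewrite /= aut_funK.
- by apply/measurable_EFinP; exact: measurable_funTS.
- by move=> z _; rewrite lee_fin.
Qed.

End quasi_invariant_flow.

(** * Large blocks of the measure nu(L_n, lambda_n) *)

Section blocks.
Context {R : realType} (L : nat -> nat) (lam : nat -> R).
Hypothesis L_gt0 : forall n, (0 < L n)%N.
Hypothesis lam_itv : forall n, 0 < lam n <= 1.
Local Notation q := (fun i => nu_ (lam (block L i))).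

Lemma block_pr i b : pr q i b =
  (if b then lam (block L i) else 1) / (1 + lam (block L i)).
Proof.
have /andP[l0 _] := lam_itv (block L i).
by have [Ef Et] := nu_E l0; rewrite /pr; case: b; rewrite (Et, Ef).
Qed.

Lemma block_pr_gt0 i b : 0 < pr q i b.
Proof.
have /andP[l0 _] := lam_itv (block L i).
by rewrite block_pr divr_gt0 ?addr_gt0//; case: b.
Qed.

Lemma block_odds i : odds q i = lam (block L i).
Proof.
have /andP[l0 _] := lam_itv (block L i).
by rewrite /odds !block_pr; field; rewrite !gt_eqF ?addr_gt0.
Qed.

Lemma block_odds_le1 i : odds q i <= 1.
Proof. by rewrite block_odds; have /andP[] := lam_itv (block L i). Qed.

(** Blocks are nonempty, so a block of index at least [k] lies beyond the coordinate [k]. *)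
Lemma leq_psum n : (n <= psum L n)%N.
Proof.
elim: n => // n ih; rewrite /psum big_ord_recr/= -addn1.
by rewrite leq_add.
Qed.

(** The first [k] terms are bounded by their sum, so an infinite supremum must come from the later
    ones. *)
Lemma unbounded_blocks (C : R) k :
  ereal_sup [set ((L n)%:R * lam n)%:E | n in [set: nat]] = +oo%E ->
  exists2 n, (k <= n)%N & C <= (L n)%:R * lam n.
Proof.
move=> supoo; apply: contrapT => H.
have a0 n : 0 <= (L n)%:R * lam n.
  by have /andP[l0 _] := lam_itv n; rewrite mulr_ge0// ltW.
suff : (ereal_sup [set ((L n)%:R * lam n)%:E | n in [set: nat]] <=
    (`|C| + \sum_(i < k) (L i)%:R * lam i)%:E)%E by rewrite supoo leye_eq.
apply: ge_ereal_sup => _ [n _ <-]; rewrite lee_fin.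
have S0 : 0 <= \sum_(i < k) (L i)%:R * lam i by apply: sumr_ge0 => i _.
have [kn|nk] := leqP k n.
  rewrite ler_wpDr// (le_trans _ (ler_norm C))// leNgt; apply/negP => Cn.
  by apply: H; exists n => //; exact: ltW.
rewrite ler_wpDl//; rewrite (bigD1 (Ordinal nk))//= lerDl.
by apply: sumr_ge0 => i _.
Qed.

Lemma block_has_large_blocks :
  ereal_sup [set ((L n)%:R * lam n)%:E | n in [set: nat]] = +oo%E ->
  has_large_blocks q.
Proof.
(* The factor 2 compensates for [lam / (1 + lam) >= lam / 2]. *)
move=> supoo K k; have [n kn Kn] := unbounded_blocks (2 * `|K|) k supoo.
have /andP[l0 l1] := lam_itv n.
have bn (m : 'I_(L n)) : block L (psum L n + m) = n.
  apply: blockP => //; rewrite leq_addr/= /psum big_ord_recr/= ltn_add2l.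
  exact: ltn_ord.
exists (L n), (fun m => psum L n + m)%N, (lam n / (1 + lam n)); split.
- by move=> m m' /addnI/val_inj.
- by move=> m; rewrite (leq_trans kn)// (leq_trans (leq_psum n))// leq_addr.
- move=> m; rewrite !block_pr bn; split => //.
  by field; rewrite gt_eqF// addr_gt0.
- rewrite divr_gt0 ?addr_gt0//= ler_pdivrMr ?addr_gt0//.
  by rewrite mulrDr mulr1; lra.
- rewrite mulrA ler_pdivlMr ?addr_gt0//; apply: le_trans Kn.
  apply: (@le_trans _ _ (`|K| * (1 + lam n))).
    by rewrite ler_wpM2r ?ler_norm// addr_ge0// ltW.
  by rewrite mulrC ler_wpM2r//; lra.
Qed.

End blocks.

Section merge_combinations.
Context {R : realType}.

(** Approximate transitivity wants one list of group elements for all [j]: take all translations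
    that occur, without repetition, and add up the coefficients of equal ones. *)
Lemma merge_combinations n (l : 'I_n -> seq (R * R)) :
  (forall j p, p \in l j -> 0 <= p.2) ->
  exists m (g : 'I_m -> R) (c : 'I_n -> 'I_m -> R),
    (forall j k, 0 <= c j k) /\
    forall (T : R -> R) j,
      \sum_(k < m) c j k * T (g k) = \sum_(p <- l j) p.2 * T p.1.
Proof.
move=> l0; pose s := undup [seq p.1 | p <- flatten [seq l j | j <- enum 'I_n]].
exists (size s), (fun k => nth 0 s k),
  (fun j k => \sum_(p <- l j | p.1 == nth 0 s k) p.2); split.
  by move=> j k; rewrite big_seq_cond; apply: sumr_ge0 => p /andP[/l0].
move=> T j.
transitivity (\sum_(k < size s) \sum_(p <- l j) if p.1 == nth 0 s k then p.2 * T p.1 else 0).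
  apply: eq_bigr => k _; rewrite mulr_suml big_mkcond/=.
  by apply: eq_bigr => p _; case: eqP => // ->.
rewrite exchange_big/=; apply: eq_big_seq => p pl.
have ps : p.1 \in s.
  rewrite mem_undup; apply: map_f; apply/flattenP; exists (l j) => //.
  by apply: map_f; rewrite mem_enum.
have ip : (index p.1 s < size s)%N by rewrite index_mem.
rewrite (bigD1 (Ordinal ip))//= nth_index// eqxx big1 ?addr0// => k kp.
case: eqP => // pk; case/negP: kp; apply/eqP/val_inj => /=.
by rewrite pk index_uniq// undup_uniq.
Qed.

End merge_combinations.

Section normal_density.
Context {R : realType} (nu : probability bitseqs R).
Local Notation leb := (@lebesgue_measure R).
Local Notation W := (bitseqs * measurableTypeR R)%type.

Lemma measurable_normal_pdf_snd :
  measurable_fun setT (fun w : W => normal_pdf 0 1 w.2 : R).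
Proof.
apply: (@measurableT_comp _ _ _ _ (measurableTypeR R) _ (normal_pdf 0 1)) => //.
exact: measurable_normal_pdf.
Qed.

Lemma product_normal_derivative : is_rn_derivative
  (nu \x normal_prob 0 1)%E (nu \x leb)%E (fun w : W => normal_pdf 0 1 w.2 : R).
Proof.
split.
- exact: measurable_normal_pdf_snd.
- by move=> w; exact: normal_pdf_ge0.
have mp : measurable_fun setT (fun w : W => (normal_pdf 0 1 w.2 : R)%:E).
  by apply/measurable_EFinP; exact: measurable_normal_pdf_snd.
move=> A mA; rewrite [RHS]integral_mkcond fubini_tonelli1/=; last 2 first.
- by apply/(measurable_restrictT _ mA); exact: measurable_funTS.
- by move=> w; rewrite patchE; case: ifP => // _; rewrite lee_fin normal_pdf_ge0.
apply: eq_integral => x _; rewrite /fubini_F /= /normal_prob [LHS]integral_mkcond.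
apply: eq_integral => t _; rewrite !patchE.
by rewrite mem_xsection.
Qed.

End normal_density.

(** * Lifting functions from the quotient and pushing the slab forward *)

Section associated_flow_quotient.
Context (R : realType) (nu : probability bitseqs R).
Context d (Z : measurableType d).
Variables (mu : {sigma_finite_measure set Z -> \bar R}) (F : R -> automorphism Z).
Local Notation leb := (@lebesgue_measure R).
Local Notation W := (bitseqs * measurableTypeR R)%type.
Local Notation m0 := (nu \x leb)%E.
Local Notation me := (nu \x @exp_measure R)%E.
Variable p : W -> Z.
Hypothesis mp : measurable_fun setT p.
Hypothesis p_null : forall A, measurable A -> mu A = 0%E <-> me (p @^-1` A) = 0%E.
Hypothesis p_rho : forall s, {ae me, forall w, p (rho s w) = F s (p w)}.
Hypothesis F_nonsingular : forall s, nonsingular mu (F s).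

Lemma measurable_quotient_preimage A : measurable A -> measurable (p @^-1` A).
Proof. by move=> mA; rewrite -[X in measurable X]setTI; exact: mp. Qed.

Lemma null_lebesgue_exp (A : set W) : measurable A -> m0 A = 0%E <-> me A = 0%E.
Proof.
move=> mA; apply: eq_product_measure_null => // B mB.
by split => /exp_measure_eq0P; exact.
Qed.

Lemma normal_pushforward_lty :
  (pushforward_measure (nu \x normal_prob 0 1)%E mp setT < +oo)%E.
Proof.
rewrite -[ltLHS]/((nu \x normal_prob 0 1)%E setT) -setXTT product_measure1E//.
rewrite lte_mul_pinfty//; first exact: fin_num_measure.
by rewrite (le_lt_trans (probability_le1 _ measurableT))// ltry.
Qed.

(** The [kappa] of the preceding section: the image of a probability with the null sets of
    [nu x e^u du] is finite and equivalent to [mu]. *)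
Definition normal_pushforward : {finite_measure set Z -> \bar R} :=
  mfrestr measurableT normal_pushforward_lty.

Lemma normal_pushforwardE A :
  normal_pushforward A = (nu \x normal_prob 0 1)%E (p @^-1` A).
Proof.
by rewrite -[LHS]/((nu \x normal_prob 0 1)%E (p @^-1` (A `&` setT))) setIT.
Qed.

Lemma normal_pushforward_null A : measurable A ->
  normal_pushforward A = 0%E <-> mu A = 0%E.
Proof.
move=> mA; rewrite normal_pushforwardE p_null//.
apply: eq_product_measure_null; last exact: measurable_quotient_preimage.
move=> B mB; rewrite exp_measure_eq0P//; exact: normal_prob_eq0P.
Qed.

Local Notation k := (rn_derivative normal_pushforward mu).

(** Dividing by [k] and weighting by the normal density produces an integrable function on W whose
    image measure on Z is [f] times [mu], see [integral_lift]. *)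
Definition lift (f : Z -> R) (w : W) : R :=
  f (p w) / k (p w) * normal_pdf 0 1 w.2.

Lemma lift_ge0 (f : Z -> R) : (forall z, 0 <= f z) -> forall w, 0 <= lift f w.
Proof.
move=> f0 w; have [_ k0 _] := kappa_derivative normal_pushforward_null.
by rewrite mulr_ge0 ?divr_ge0// normal_pdf_ge0.
Qed.

Lemma measurable_div_density (f : Z -> R) : measurable_fun setT f ->
  measurable_fun setT (fun z => f z / k z).
Proof.
move=> mf; have [mk k0 _] := kappa_derivative normal_pushforward_null.
by apply: measurable_funM => //; exact: measurable_invr_ge0.
Qed.

Lemma measurable_lift (f : Z -> R) : measurable_fun setT f -> measurable_fun setT (lift f).
Proof.
move=> mf; apply: measurable_funM; last exact: measurable_normal_pdf_snd.
by apply: (measurableT_comp (measurable_div_density mf)).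
Qed.

Lemma integral_lift (f : Z -> R) P : measurable_fun setT f -> (forall z, 0 <= f z) ->
  measurable P ->
  (\int[m0]_(w in p @^-1` P) (lift f w)%:E = \int[mu]_(z in P) (f z)%:E)%E.
Proof.
move=> mf f0 mP; have [mk k0 _] := kappa_derivative normal_pushforward_null.
have mfk := measurable_div_density mf.
rewrite -(integral_kappa_inv normal_pushforward_null)//.
transitivity (\int[pushforward_measure (nu \x normal_prob 0 1)%E mp]_(z in P)
    (f z / k z)%:E)%E; last first.
  by apply: eq_measure_integral => A mA _; rewrite [RHS]normal_pushforwardE.
rewrite /pushforward_measure ge0_integral_pushforward//=; last 2 first.
- by apply/measurable_EFinP; exact: measurable_funTS.
- by move=> z _; rewrite lee_fin divr_ge0.
rewrite (is_rn_derivative_integral (product_normal_derivative nu))//.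
- exact: measurable_quotient_preimage.
- apply/measurable_EFinP; apply: measurable_funTS.
  exact: (measurableT_comp mfk).
- by move=> w _; rewrite lee_fin divr_ge0.
Qed.

Variable N : nat.
Local Notation delta := ((2 ^+ N)^-1 : R).

Definition base_slab : set W :=
  slab delta setT 0 `&` (fst @^-1` prefix N (fun=> false)).

Lemma measurable_base_slab : measurable base_slab.
Proof.
apply: measurableI; first exact: measurable_slab.
rewrite -[X in measurable X]setTI; apply: measurable_fst => //.
exact: measurable_prefix.
Qed.

Lemma base_slab_lty :
  (pushforward_measure (mrestr m0 measurable_base_slab) mp setT < +oo)%E.
Proof.
rewrite -[ltLHS]/(m0 (setT `&` base_slab)) setTI.
rewrite slab_prefix_measure ?ltry//; exact: measurable_prefix.
Qed.

Definition base_measure : {finite_measure set Z -> \bar R} :=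
  mfrestr measurableT base_slab_lty.

Lemma base_measureE P : base_measure P = m0 ((p @^-1` P) `&` base_slab).
Proof.
by rewrite -[LHS]/(m0 ((p @^-1` (P `&` setT)) `&` base_slab)) setIT.
Qed.

(** The function [f] of approximate transitivity: the density of the image of Lebesgue measure
    restricted to the slab over the zero word. *)
Definition base_fun : Z -> R := rn_derivative base_measure mu.

Lemma base_fun_derivative : is_rn_derivative base_measure mu base_fun.
Proof.
apply: rn_derivativeP; apply/null_content_dominatesP => A mA /p_null.
move=> /(_ mA) A0; rewrite [LHS]base_measureE.
have mpA := measurable_quotient_preimage mA.
apply: (subset_measure0 _ mpA); last exact/null_lebesgue_exp.
- by apply: measurableI => //; exact: measurable_base_slab.
- by move=> w [].
Qed.

(** [beta] replaces [P] by its preimage under [F s]; since [p] intertwines [rho s] and [F s] almost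
    everywhere, this shifts the slab by [s] on W. *)
Lemma integral_beta_base_fun s P : measurable P ->
  (\int[mu]_(z in P) (beta mu (F s) base_fun z)%:E =
  (zero_slab nu N (p @^-1` P) s)%:E)%E.
Proof.
move=> mP; have [mb b0 bE] := base_fun_derivative.
have mFP : measurable (F s @^-1` P).
  by rewrite -[X in measurable X]setTI; exact: (measurable_aut_fun (F s)).
have mQ := measurable_quotient_preimage mP.
rewrite (integral_beta normal_pushforward_null)// -bE// [LHS]base_measureE.
rewrite -slab_prefix_measure//; last exact: measurable_prefix.
have [A [mA A0 pA]] := p_rho s.
apply: (@eq_measure_setD0 _ _ _ m0 _ _ A) => //.
- apply: measurableI; last exact: measurable_base_slab.
  exact: measurable_quotient_preimage.
- apply: measurableI; first exact: measurable_slab.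
  rewrite -[X in measurable X]setTI; apply: measurable_fst => //.
  exact: measurable_prefix.
- exact/null_lebesgue_exp.
move=> w nAw.
have pw : p (rho s w) = F s (p w) by apply: contrapT => np; apply: nAw; exact: pA.
rewrite /base_slab /slab/= -[p (w.1, w.2 + s)]/(p (rho s w)) pw.
tauto.
Qed.

End associated_flow_quotient.

Theorem theorem3p6 (R : realType) (L : nat -> nat) (lam : nat -> R)
  (L_gt0 : forall n, (0 < L n)%N)
  (lam_itv : forall n, 0 < lam n <= 1)
  (sup_infty : ereal_sup [set ((L n)%:R * lam n)%:E | n in [set: nat]] = +oo%E)
  (nu : probability bitseqs R) (nuE : is_nu L lam nu)
  (d : measure_display) (Z : measurableType d)
  (mu : {sigma_finite_measure set Z -> \bar R}) (F : R -> automorphism Z) :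
  is_associated_flow nu natural_action mu F ->
  approximately_transitive mu F.
Proof.
move=> [_ [_ _ _ Fns] [p [mp pnull pinv prho]]] n f eps f_L1 eps0.
have pr_gt0 := block_pr_gt0 L lam_itv.
have odds_le1 := block_odds_le1 L lam_itv.
have large := block_has_large_blocks L_gt0 lam_itv sup_infty.
have mpre A : measurable A -> measurable (p @^-1` A).
  exact: measurable_quotient_preimage mp A.
have inv_preimage A : measurable A -> invariant_set nu (p @^-1` A).
  move=> mA; split; first exact: mpre.
  (* The indicator of the preimage is that of [A] composed with [p], hence it comes from L^oo(Z) and
     is invariant. *)
  move=> g; have [_ H] := pinv (\1_(p @^-1` A)) (indic_Lfun_infty _ (mpre _ mA)).
  have {}H : {ae (nu \x @exp_measure R)%E, forall w,
      \1_(p @^-1` A) (gamma nu natural_action g w) = \1_(p @^-1` A) w :> R}.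
    by apply: H; exists (\1_A); [exact: indic_Lfun_infty|exact: aeW].
  apply: filterS H => w; rewrite !indicE => /eqP; rewrite eqr_nat.
  (* [odd] recovers the booleans from the equality of their numerical values. *)
  move=> /eqP/(congr1 odd); rewrite !oddb => Aw.
  by split => /mem_set Bw; apply/set_mem; [rewrite -Aw|rewrite Aw].
have e2 : 0 < eps / 2 by rewrite divr_gt0.
have int_f j : mu.-integrable setT (EFin \o f j).
  by apply/Lfun1_integrable; have [] := f_L1 j.
have f0 j z : 0 <= f j z by have [_] := f_L1 j.
have mf j : measurable_fun setT (f j).
  by apply/measurable_EFinP; exact: measurable_int (int_f j).
pose phi j := lift nu mu mp (f j).
have phi_int j P : measurable P ->
    (\int[nu \x @lebesgue_measure R]_(w in p @^-1` P) (phi j w)%:E =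
     \int[mu]_(z in P) (f j z)%:E)%E.
  by move=> mP; apply: integral_lift.
have phi_approx j : approximable nu (fun Q =>
    fine (\int[nu \x @lebesgue_measure R]_(w in Q) (phi j w)%:E)%E).
  apply: (approximable_integrable nuE pr_gt0 odds_le1 large).
  - exact: measurable_lift.
  - exact: lift_ge0.
  - rewrite -(preimage_setT p) phi_int//.
    have /integrableP[_] := int_f j.
    by under eq_integral do rewrite /= ger0_norm//.
have /choice[N0 HN0] : forall j, exists N0, forall N, (N0 <= N)%N ->
    near_combination nu N (eps / 2) (fun Q =>
    fine (\int[nu \x @lebesgue_measure R]_(w in Q) (phi j w)%:E)%E).
  by move=> j; exact: phi_approx.
(* A level beyond the thresholds of all the [f j]: they share the zero slab. *)
pose N := (\max_(j < n) N0 j)%N.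
have /choice[l Hl] : forall j, exists l : seq (R * R),
    (forall r, r \in l -> 0 <= r.2) /\ close_to nu (eps / 2) (fun Q =>
    fine (\int[nu \x @lebesgue_measure R]_(w in Q) (phi j w)%:E)%E)
    (combination nu N l).
  by move=> j; apply: HN0; exact: leq_bigmax.
have [m [g [c [c0 cE]]]] := merge_combinations (fun j => (Hl j).1).
pose b := base_fun nu mu mp N.
have [mb b0 bE] := base_fun_derivative mp pnull N.
have b_int s P : measurable P -> (\int[mu]_(z in P) (beta mu (F s) b z)%:E =
    (zero_slab nu N (p @^-1` P) s)%:E)%E.
  by move=> mP; exact: integral_beta_base_fun.
exists b; split.
  split; last exact: b0.
  apply/Lfun1_integrable; apply: ge0_integrable => //.
  by rewrite -bE// ltey_eq fin_num_measure.
exists m, g, c; split => // j.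
have mbeta s : measurable_fun setT (beta mu (F s) b).
  exact: (measurable_beta (normal_pushforward_null mp pnull)).
have beta0 s z : 0 <= beta mu (F s) b z.
  exact: (beta_ge0 (normal_pushforward_null mp pnull)).
pose G z := \sum_(k < m) c j k * beta mu (F (g k)) b z.
have G0 z : 0 <= G z by apply: sumr_ge0 => k _; rewrite mulr_ge0.
have mG : measurable_fun setT G.
  by apply: measurable_sum => k; exact: measurable_funM.
have G_int P : measurable P -> (\int[mu]_(z in P) (G z)%:E =
    (combination nu N (l j) (p @^-1` P))%:E)%E.
  move=> mP; rewrite /combination -cE -sumEFin.
  under eq_integral do rewrite /G -sumEFin.
  rewrite ge0_integral_sum//; last 2 first.
  - move=> k; apply/measurable_EFinP; apply: measurable_funTS.
    exact: measurable_funM.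
  - by move=> k z _; rewrite lee_fin mulr_ge0.
  apply: eq_bigr => k _; under eq_integral do rewrite EFinM.
  rewrite ge0_integralZl_EFin//; last 2 first.
  - by move=> z _; rewrite lee_fin.
  - by apply/measurable_EFinP; exact: measurable_funTS.
  by rewrite b_int// EFinM.
(* Setwise precision [eps / 2] costs a factor 2 in the norm. *)
rewrite (splitr eps); apply: Lnorm1_le_setwise => //.
  by apply: ge0_integrable => //; rewrite G_int// ltry.
move=> P mP; rewrite /Rintegral G_int// -phi_int//.
by have [_ H] := Hl j; apply: H; exact: inv_preimage.
Qed.
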